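(* Fix partitions $\mu,\nu$. Let $\mu\Delta\nu=(\mu\setminus\nu)\cup(\nu\setminus\mu)$ be the symmetric difference of their Young diagrams and $|\mu\Delta\nu|$ its number of boxes. Then: (I) There exists a partition $\lambda$ with $|\lambda|=k$ and $N_{\mu,\nu,\lambda}>0$ if and only if $k\equiv|\mu\Delta\nu| \pmod 2$ and $|\mu\Delta\nu|\leq k\leq|\mu|+|\nu|$. (II) If $\lambda$ is a partition with $N_{\mu,\nu,\lambda}>0$ and $|\lambda|>|\mu\Delta\nu|$, then there exists a partition $\lambda^{\downarrow\downarrow}$ such that $N_{\mu,\nu,\lambda^{\downarrow\downarrow}}>0$, $\lambda^{\downarrow\downarrow}\subset\lambda$ and $|\lambda^{\downarrow\downarrow}|=|\lambda|-2$. (III) If $\lambda$ is a partition with $N_{\mu,\nu,\lambda}>0$ and $|\lambda|<|\mu|+|\nu|$, then there exists a partition $\lambda^{\uparrow\uparrow}$ such that $N_{\mu,\nu,\lambda^{\uparrow\uparrow}}>0$, $\lambda\subset\lambda^{\uparrow\uparrow}$ and $|\lambda^{\uparrow\uparrow}|=|\lambda|+2$.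
   Context: Partitions are identified with their Young diagrams (aligned at the northwest corner); $|\lambda|$ is the number of boxes, and $\subset$ is containment of diagrams. Let $c_{\alpha,\beta}^{\mu}$ denote the Littlewood-Richardson coefficient, i.e. $s_\alpha s_\beta=\sum_\mu c_{\alpha,\beta}^\mu s_\mu$ for Schur functions. The Newell-Littlewood number of partitions $\mu,\nu,\lambda$ is $$N_{\mu,\nu,\lambda}=\sum_{\alpha,\beta,\gamma} c_{\alpha,\beta}^{\mu}c_{\alpha,\gamma}^{\nu}c_{\beta,\gamma}^{\lambda},$$ where the sum is over all triples of partitions (only finitely many terms are nonzero). *)

(* Defs.v *)
From HB Require Import structures.
From Stdlib Require Import ClassicalEpsilon.
From mathcomp Require Import all_boot all_order all_algebra.
From mathcomp Require Import finmap mpoly.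

Set Implicit Arguments.
Unset Strict Implicit.
Unset Printing Implicit Defensive.

Import GRing.Theory.

(* A partition is the weakly decreasing sequence of its nonzero parts; its
   size is [sumn l] (see [card_young]). *)
Definition is_part (l : seq nat) : bool := sorted geq l && (0 \notin l).

(* A partition of d has at most d parts, each at most d, so it is obtained from
   some d-tuple over 'I_d.+1 by removing zeros (see [mem_partitions]). *)
Definition partitions (d : nat) : seq (seq nat) :=
  [seq l <- undup [seq [seq x <- map val (tval t) | x != 0]
                  | t <- enum {: d.-tuple 'I_d.+1}]
  | is_part l && (sumn l == d)].

Definition partitions_upto (d : nat) : seq (seq nat) :=
  [seq l | e <- iota 0 d.+1, l <- partitions e].

(* Boxes are pairs (row, column), both counted from 0, row 0 at the top. *)
Definition young (l : seq nat) : {fset nat * nat} :=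
  [fset c in [seq (i, j) | i <- iota 0 (size l), j <- iota 0 (nth 0 l i)]]%fset.

Definition young_symdiff (m n : seq nat) : {fset nat * nat} :=
  ((young m `\` young n) `|` (young n `\` young m))%fset.

Lemma in_young l i j : ((i, j) \in young l) = (j < nth 0 l i).
Proof.
rewrite in_fset /=; apply/allpairsPdep/idP => /=.
  by case=> [a [b [_ + [-> ->]]]]; rewrite mem_iota.
move=> lt_j; exists i, j; split=> //; rewrite mem_iota //=.
by rewrite add0n ltnNge; apply/negP => ge_i; rewrite nth_default in lt_j.
Qed.

Lemma card_young l : #|` young l|%fset = sumn l.
Proof.
rewrite card_fseq undup_id; last first.
  apply: allpairs_uniq_dep => [|i _|[a b] [c d] _ _ /= [-> ->]//];
  exact: iota_uniq.
rewrite size_allpairs_dep; congr sumn.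
under eq_map => i do rewrite size_iota.
exact: mkseq_nth.
Qed.

Lemma uniq_partitions d : uniq (partitions d).
Proof. exact: filter_uniq (undup_uniq _). Qed.

Lemma mem_partitions d l :
  (l \in partitions d) = is_part l && (sumn l == d).
Proof.
rewrite mem_filter mem_undup; apply/andP/idP => [[]//|pl]; split=> //.
have /andP[/andP[_ nz] /eqP sl] := pl.
have le_d x : x \in l -> x <= d.
  rewrite -sl; elim: (l) => //= a s IH; rewrite inE.
  case/predU1P=> [->|/IH le_x]; first exact: leq_addr.
  exact: leq_trans le_x (leq_addl _ _).
have sz_l : size l <= d.
  rewrite -sl; elim: (l) nz => //= a s IH; rewrite inE negb_or => /andP[a0 /IH].
  by rewrite -[(size s).+1]add1n; apply: leq_add; rewrite lt0n eq_sym.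
pose s : seq 'I_d.+1 := map inord l ++ nseq (d - size l) ord0.
have sz_s : size s == d by rewrite size_cat size_map size_nseq subnKC.
apply/mapP; exists (Tuple sz_s); first by rewrite mem_enum.
rewrite /= map_cat filter_cat map_nseq.
have -> : [seq x <- nseq (d - size l) (val (@ord0 d)) | x != 0] = [::].
  by elim: (d - size l).
rewrite cats0 -map_comp map_id_in => [|x /le_d le_x /=]; last exact: inordK.
by rewrite (all_filterP _) //; apply/allP => x xl; apply: contraNneq nz => <-.
Qed.

Lemma mem_partitions_upto d l :
  (l \in partitions_upto d) = is_part l && (sumn l <= d).
Proof.
apply/allpairsPdep/andP => [[e [m [+ + ->]]]|[pl le_d]].
  by rewrite mem_iota /= add0n ltnS mem_partitions => le_e /andP[-> /eqP->].
by exists (sumn l), l; rewrite mem_iota /= add0n ltnS mem_partitions pl eqxx.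
Qed.

Lemma uniq_partitions_upto d : uniq (partitions_upto d).
Proof.
apply: allpairs_uniq_dep => [|e _|]; [exact: iota_uniq|exact: uniq_partitions|].
move=> _ _ /allpairsPdep[e [x [_ xe ->]]] /allpairsPdep[f [y [_ yf ->]]] /= xy.
move: xe yf; rewrite -{}xy !mem_partitions => /andP[_ /eqP<-] /andP[_ /eqP<-].
by [].
Qed.

Definition is_ssyt (n : nat) (l : seq nat) (T : {ffun young l -> 'I_n}) : bool :=
  [forall c : young l, forall c' : young l,
    (((val c).1 == (val c').1) && ((val c).2 <= (val c').2) ==> (T c <= T c'))
    && (((val c).2 == (val c').2) && ((val c).1 < (val c').1) ==> (T c < T c'))].

Local Open Scope ring_scope.

(* The Schur function of l, restricted to n variables. *)
Definition schur (n : nat) (l : seq nat) : {mpoly int[n]} :=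
  \sum_(T : {ffun young l -> 'I_n} | is_ssyt T) \prod_(c : young l) 'X_(T c).

(* An identity of symmetric functions is an identity between their restrictions
   to n variables, for all n. Schur functions being homogeneous, only the s_mu
   with |mu| = |alpha| + |beta| can occur in s_alpha s_beta. *)
Definition schur_product_expansion
    (alpha beta : seq nat) (c : seq nat -> int) : Prop :=
  forall n : nat, schur n alpha * schur n beta =
    \sum_(mu <- partitions (sumn alpha + sumn beta)) c mu *: schur n mu.

(* The expansion exists and its coefficients are unique because the Schur
   functions form a Z-basis of the ring of symmetric functions; [epsilon]
   selects it. *)
Definition LRcoef (alpha beta mu : seq nat) : int :=
  if mu \in partitions (sumn alpha + sumn beta)
  then epsilon (inhabits (fun _ => 0)) (schur_product_expansion alpha beta) mu
  else 0.

(* A nonzero term has |alpha| + |beta| = |mu| and |alpha| + |gamma| = |nu|, so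
   these bounds lose nothing from the sum over all triples of partitions. *)
Definition NLnumber (mu nu lambda : seq nat) : int :=
  \sum_(alpha <- partitions_upto (sumn mu))
    \sum_(beta <- partitions_upto (sumn mu))
      \sum_(gamma <- partitions_upto (sumn nu))
        LRcoef alpha beta mu * LRcoef alpha gamma nu * LRcoef beta gamma lambda.

(* Main.v *)
Require Import Defs.
From mathcomp Require Import all_boot all_order all_algebra finmap mpoly.
From mathcomp Require Import fingroup perm zify.

(** Write c(a,b;mu) for the Littlewood-Richardson coefficients. A summand of the
    Newell-Littlewood number is nonzero for a triple (a,b,g) with c(a,b;mu),
    c(a,g;nu) and c(b,g;lambda) positive. Then a is contained in both mu and nu,
    and |lambda| = |b| + |g| = |mu| + |nu| - 2|a|, while the symmetric difference
    has |mu| + |nu| - 2|mu /\ nu| boxes: this gives the parity and the bounds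
    on |lambda|, and it says that changing |lambda| by two amounts to moving one
    box between a and both b and g.

    To shrink lambda, choose a box that can be added to a inside mu /\ nu. The
    key point ([LRcoef_transfer]) is that the box may be prescribed: if
    c(a,b;mu) > 0 and a' is a plus a box inside mu, then c(a',b';mu) > 0 for some
    b' equal to b minus a box. Applied to mu and to nu with the same a', it turns
    (a,b,g) into (a',b',g'), and the Pieri rule ([LRcoef_pieri]) turns
    c(b,g;lambda) > 0 into c(b',g';l) > 0 for an l obtained from lambda by
    removing two boxes. To grow lambda, remove any box from a; the Pieri rule
    and associativity ([LRcoef_exchange]) add a box to b and to g, and
    [LRcoef_extend] adds two boxes to lambda. All sizes in between
    occur by shrinking repeatedly from a empty, where |lambda| = |mu| + |nu|.

    The transfer lemma is proved on Littlewood-Richardson tableaux. A tableau of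
    shape b is stored as its array of row lengths restricted to the entries < k,
    together with the partitions reached from a while its rows are read. Starting
    from a' the first letter r, the row of the new box, has to be dropped; each
    failure of column strictness that this causes moves to the next row of the
    tableau until it disappears ([repair_column_strict]).

    Pieri's rule and [LRcoef_extend] come from polynomial identities for the
    bialternants: multiplication by the sum of the variables adds a box, and the
    derivation sum_i d/dx_i, which kills the Vandermonde alternant, removes a box
    with positive coefficients. For the latter the product rule shows that the
    coefficient of s_l in the derivative of s_b' s_g is at least a positive
    multiple of c(b,g;l) when b' is b plus a box.

    Both arguments need the Littlewood-Richardson rule, which is proved as in
    Stembridge's note: the product of the alternant of a by the Schur polynomial
    of b is a sum of alternants over all tableaux of shape b, in which the
    tableaux that violate the Yamanouchi condition cancel in pairs under
    Bender-Knuth involutions ([alternant_mul_schur]). On arrays of row lengths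
    these involutions are piecewise linear reflections. *)

Set Implicit Arguments.
Unset Strict Implicit.
Unset Printing Implicit Defensive.

(* The iterated sums are abstracted by unification before [lia] looks for its
   atoms. *)
Local Ltac lia_sums :=
  repeat (let S := fresh "S" in set S := bigop _ _ _; move: S => ?); lia.

(** * Gelfand-Tsetlin arrays and Yamanouchi conditions *)

(** The array [p k i], the number of entries smaller than [k] in row [i],
    encodes a semistandard tableau of shape [b] with entries smaller than [n];
    the last clause is column strictness. *)
Definition gelfand_tsetlin (n : nat) (b : nat -> nat) (p : nat -> nat -> nat) :=
  [/\ forall i, p 0 i = 0,
      forall k i, n <= k -> p k i = b i,
      forall k i, p k i <= p k.+1 i
    & forall k i, p k.+1 i.+1 <= p k i].

(** Truncated subtraction of [j] discards the columns [< j]: this is the number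
    of letters [k] in the other columns, read first by the column word. *)
Definition letters_right (N : nat) (p : nat -> nat -> nat) (j k : nat) : nat :=
  \sum_(i < N) ((p k.+1 i - j) - (p k i - j)).

Definition yamanouchi_at N (a : nat -> nat) p j k : bool :=
  a k.+1 + letters_right N p j k.+1 <= a k + letters_right N p j k.

(** The same condition for the reading word of the rows: after the letters
    [k.+1] of row [i] have been read, but not yet its letters [k]. *)
Definition row_yamanouchi (a : nat -> nat) (p : nat -> nat -> nat) i k : Prop :=
  a k.+1 + \sum_(l < i.+1) (p k.+2 l - p k.+1 l)
    <= a k + \sum_(l < i) (p k.+1 l - p k l).

Section Arrays.

Variables (n N : nat) (b : nat -> nat).
Hypothesis b_out : forall i, N <= i -> b i = 0.
Implicit Type p : nat -> nat -> nat.

Lemma gt_mono p : gelfand_tsetlin n b p ->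
  forall k k' i, k <= k' -> p k i <= p k' i.
Proof.
case=> _ _ pS _ k k' i /subnK <-; elim: (k' - k) => [|d IH] //.
by rewrite addSn; apply: leq_trans IH (pS _ _).
Qed.

Lemma gt_le_shape p : gelfand_tsetlin n b p -> forall k i, p k i <= b i.
Proof.
move=> gtp k i; have [_ pn _ _] := gtp.
by rewrite -(pn (maxn k n)) ?leq_maxr //; apply: (gt_mono gtp); apply: leq_maxl.
Qed.

Lemma gt_row_out p : gelfand_tsetlin n b p -> forall k i, N <= i -> p k i = 0.
Proof.
by move=> gtp k i /b_out bi; have := gt_le_shape gtp k i; rewrite bi leqn0 => /eqP.
Qed.

Lemma gt_anti p : gelfand_tsetlin n b p ->
  forall k i i', i <= i' -> p k i' <= p k i.
Proof.
move=> gtp k i i' /subnK <-; elim: (i' - i) => [|d IH] //; rewrite addSn.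
have [_ _ pS pSS] := gtp.
exact: leq_trans (leq_trans (pS _ _) (pSS _ _)) IH.
Qed.

Lemma gt_diag p : gelfand_tsetlin n b p -> forall k i, k <= i -> p k i = 0.
Proof.
case=> p0 _ _ pSS; elim=> [|k IH] [|i] //= ki.
by apply/eqP; rewrite -leqn0 -(IH i).
Qed.

(** Compare the column word read down to column [j] with the row word read through
    the last row that reaches beyond it. The letters that only the latter has read
    lie left of column [j], and there row [l.+1] has at least as many letters
    [k.+1] as row [l] has letters [k]. *)
Lemma row_to_column_yamanouchi a p : gelfand_tsetlin n b p ->
  (forall i k, row_yamanouchi a p i k) ->
  forall j k, yamanouchi_at N a p j k.
Proof.
move=> gtp rowY j k; rewrite /yamanouchi_at /letters_right.
have [_ _ pS pSS] := gtp.
(* The rows reaching beyond column j with a letter <= k.+1 are the first m. *)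
have [m [mN m_in m_out]] : exists m, [/\ m <= N,
    forall i, i < m -> j < p k.+2 i & forall i, m <= i -> p k.+2 i <= j].
  have ex : exists m, (m <= N) && (p k.+2 m <= j).
    by exists N; rewrite leqnn (gt_row_out gtp).
  case: (ex_minnP ex) => m /andP[mN mj] mmin; exists m; split=> // i.
    move=> im; rewrite ltnNge; apply/negP => ij.
    by have := mmin i; rewrite ij andbT; lia.
  by move=> mi; apply: leq_trans mj; apply: (gt_anti gtp).
have split_N (f : nat -> nat) : \sum_(i < N) f i = \sum_(i < m) f i + \sum_(m <= i < N) f i.
  by rewrite -!(big_mkord xpredT f) /= -big_cat_nat.
have tail : \sum_(m <= i < N) ((p k.+2 i - j) - (p k.+1 i - j)) = 0.
  rewrite big_nat big1 // => i /andP[mi _].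
  by have := m_out i mi; have := pS k.+1 i; lia.
rewrite (split_N (fun i => p k.+2 i - j - (p k.+1 i - j))) tail addn0.
rewrite (split_N (fun i => p k.+1 i - j - (p k i - j))).
case: m mN m_in {m_out split_N tail} => [|i] iN m_in.
  rewrite big_ord0 addn0.
  have := rowY 0 k; rewrite /row_yamanouchi big_ord0 addn0; lia.
have := rowY i k; rewrite /row_yamanouchi.
(* Row l loses at most as many letters k as row l.+1 loses letters k.+1. *)
suff loss: \sum_(l < i) (p k.+1 l - p k l) +
    \sum_(l < i.+1) ((p k.+2 l - j) - (p k.+1 l - j))
    <= \sum_(l < i) ((p k.+1 l - j) - (p k l - j)) +
       \sum_(l < i.+1) (p k.+2 l - p k.+1 l).
  rewrite [X in _ <= a k + (X + _)]big_ord_recr /=.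
  move: loss; lia_sums.
have pj l : l <= i -> j < p k.+2 l by move=> li; apply: m_in.
elim: i {iN m_in} pj => [|i IH] pj.
  rewrite !big_ord_recr !big_ord0 /=.
  by have := pj 0 isT; have := pS k 0; have := pS k.+1 0; lia.
have := IH (fun l h => pj l (leqW h)).
rewrite !(@big_ord_recr _ _ _ i.+1) /= !(@big_ord_recr _ _ _ i) /=.
have := pj i.+1 (leqnn _); have := pj i (leqW (leqnn _)).
have := pS k i; have := pS k.+1 i; have := pSS k i.
have := pS k i.+1; have := pS k.+1 i.+1; have := pSS k.+1 i.
lia_sums.
Qed.

Lemma column_to_row_yamanouchi a p : gelfand_tsetlin n b p ->
  (forall k, a k.+1 <= a k) ->
  (forall j k, yamanouchi_at N a p j k) ->
  forall i k, row_yamanouchi a p i k.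
Proof.
move=> gtp a_anti colY i k; rewrite /row_yamanouchi.
have [_ _ pS pSS] := gtp.
(* To the right of column p k.+1 i lie exactly the letters read so far. *)
have := colY (p k.+1 i) k; rewrite /yamanouchi_at /letters_right.
have ext (f : nat -> nat) : (forall l, N <= l -> f l = 0) ->
    \sum_(l < N) f l = \sum_(l < N + i.+1) f l.
  move=> f0; rewrite big_split_ord /= [X in _ + X]big1 ?addn0 // => l _.
  by rewrite f0 // leq_addr.
rewrite (ext (fun l => p k.+2 l - p k.+1 i - (p k.+1 l - p k.+1 i))); last first.
  by move=> l Nl; rewrite !(gt_row_out gtp _ Nl).
rewrite (ext (fun l => p k.+1 l - p k.+1 i - (p k l - p k.+1 i))); last first.
  by move=> l Nl; rewrite !(gt_row_out gtp _ Nl).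
rewrite (addnC N) !big_split_ord /=.
set S1 := \sum_(l < i.+1) (_ - _ - _); set S2 := \sum_(l < N) _.
set S3 := \sum_(l < i.+1) (_ - _ - _); set S4 := \sum_(l < N) _.
have -> : S1 = \sum_(l < i.+1) (p k.+2 l - p k.+1 l).
  apply: eq_bigr => l _; have := gt_anti gtp k.+1 (ltn_ord l : l <= i).
  by have := pS k.+1 l; lia.
have -> : S4 = 0.
  apply: big1 => l _.
  by have := gt_anti gtp k.+1 (leq_trans (leqnSn i) (leq_addr l i.+1)); lia.
have -> : S3 = \sum_(l < i) (p k.+1 l - p k l).
  rewrite /S3 big_ord_recr /= subnn sub0n addn0; apply: eq_bigr => l _.
  have := pSS k l; have := gt_anti gtp k.+1 (ltn_ord l).
  by have := pS k l; lia.
lia_sums.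
Qed.

End Arrays.

(** * Bender-Knuth involutions *)

(** Exchanges the multiplicities of the letters [k] and [k.+1] in the columns
    [< j]. On arrays this is the reflection of level [k.+1] inside the interval
    that levels [k] and [k.+2], cut at column [j], leave to each entry; the
    entries beyond column [j] are kept. *)
Definition toggle (j k : nat) (p : nat -> nat -> nat) : nat -> nat -> nat :=
  fun k' i => if (k' != k.+1) || (j < p k.+1 i) then p k' i else
    minn (minn j (p k.+2 i)) (if i is i'.+1 then p k i' else j)
      + maxn (p k.+2 i.+1) (p k i) - p k.+1 i.

(** Column [j] contains the letter [k] nowhere: then cutting at column [j] and
    gluing back after a toggle keeps the rows weakly increasing. *)
Definition column_free (j k : nat) (p : nat -> nat -> nat) : Prop :=
  forall i, j < p k.+1 i -> j < p k i.

Section Toggle.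

Variables (n N : nat) (b : nat -> nat).
Hypothesis b_out : forall i, N <= i -> b i = 0.
Variables (j k : nat) (p : nat -> nat -> nat).
Hypothesis gtp : gelfand_tsetlin n b p.
Hypothesis free : column_free j k p.

Local Notation p' := (toggle j k p).

Lemma toggle_level i : p' k.+1 i = if j < p k.+1 i then p k.+1 i else
    minn (minn j (p k.+2 i)) (if i is i'.+1 then p k i' else j)
      + maxn (p k.+2 i.+1) (p k i) - p k.+1 i.
Proof. by rewrite /toggle eqxx. Qed.

Lemma toggle_other k' : k' != k.+1 -> p' k' =1 p k'.
Proof. by move=> kk i; rewrite /toggle kk. Qed.

Lemma toggle_bounds i :
  [/\ p k i <= p' k.+1 i, p' k.+1 i <= p k.+2 i,
      p k.+2 i.+1 <= p' k.+1 i & p' k.+1 i.+1 <= p k i].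
Proof.
have [_ _ pS pSS] := gtp; rewrite !toggle_level.
have := @free i; have := @free i.+1.
have := pS k i; have := pS k.+1 i; have := pSS k.+1 i; have := pSS k i.
have := pS k i.+1; have := pS k.+1 i.+1; have := pSS k.+1 i.+1.
case: i => [|i]; last first.
  have := pSS k i; have := pSS k.+1 i; have := pS k i; have := pS k.+1 i.
  by move=> *; do 2!case: ifP => ?; split; lia.
by move=> *; do 2!case: ifP => ?; split; lia.
Qed.

Lemma toggle_gt : k.+1 < n -> gelfand_tsetlin n b p'.
Proof.
move=> kn; have [p0 pn pS pSS] := gtp; split=> [i|k' i nk|k' i|k' i].
- by rewrite toggle_other.
- by rewrite toggle_other ?pn //; lia.
- have [->|ne1] := eqVneq k' k.
    by rewrite toggle_other ?ltn_eqF //; case: (toggle_bounds i).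
  have [->|ne2] := eqVneq k' k.+1.
    by rewrite (@toggle_other k.+2) ?gtn_eqF //; case: (toggle_bounds i).
  by rewrite !toggle_other.
have [->|ne1] := eqVneq k' k.
  by rewrite (toggle_other (k' := k)) ?ltn_eqF //; case: (toggle_bounds i).
have [->|ne2] := eqVneq k' k.+1.
  by rewrite (@toggle_other k.+2) ?gtn_eqF //; case: (toggle_bounds i).
by rewrite !toggle_other.
Qed.

Lemma toggle_beyond i : (j < p' k.+1 i) = (j < p k.+1 i).
Proof.
have [_ _ pS pSS] := gtp; rewrite toggle_level.
have := pS k i; have := pS k.+1 i; have := pSS k.+1 i; have := pSS k i.
case: i => [|i]; last first.
  have := pSS k i; have := pSS k.+1 i; have := pS k i; have := pS k.+1 i.
  by move=> *; case: ifP => * /=; lia.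
by move=> *; case: ifP => * /=; lia.
Qed.

Lemma toggleK : toggle j k p' =2 p.
Proof.
move=> k' i; have [->|ne] := eqVneq k' k.+1; last first.
  by rewrite {1}/toggle ne /= toggle_other.
rewrite {1}/toggle eqxx /= toggle_beyond.
have [_ _ pS pSS] := gtp; rewrite toggle_level.
rewrite !(@toggle_other k.+2) ?gtn_eqF // !(@toggle_other k) ?ltn_eqF //.
have := pS k i; have := pS k.+1 i; have := pSS k.+1 i; have := pSS k i.
case: i => [|i]; last first.
  rewrite (@toggle_other k) ?ltn_eqF //.
  have := pSS k i; have := pSS k.+1 i; have := pS k i; have := pS k.+1 i.
  by move=> *; do 2!case: ifP => ?; lia.
by move=> *; do 2!case: ifP => ?; lia.
Qed.

Lemma toggle_letters_right j' c : j <= j' ->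
  letters_right N p' j' c = letters_right N p j' c.
Proof.
move=> jj; suff same k' i : p' k' i - j' = p k' i - j'.
  by apply: eq_bigr => i _; rewrite !same.
have [->|ne] := eqVneq k' k.+1; last by rewrite toggle_other.
by have := toggle_beyond i; rewrite toggle_level; case: ifP => ? ?; lia.
Qed.

(** The reflection replaces an entry by the sum of its two bounds minus itself;
    with a shift of one row, the two bounds add up to levels [k] and [k.+2]. *)
Lemma toggle_cut_sum :
  \sum_(i < N) minn (p' k.+1 i) j + \sum_(i < N) minn (p k.+1 i) j
  = \sum_(i < N) minn (p k.+2 i) j + \sum_(i < N) minn (p k i) j.
Proof.
have [_ _ pS pSS] := gtp.
pose up i := minn (minn j (p k.+2 i)) (if i is i'.+1 then p k i' else j).
pose lo i := minn (maxn (p k.+2 i.+1) (p k i)) j.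
have term i : minn (p' k.+1 i) j + minn (p k.+1 i) j = up i + lo i.
  rewrite toggle_level /up /lo; have := @free i.
  have := pS k i; have := pS k.+1 i; have := pSS k.+1 i; have := pSS k i.
  case: i => [|i]; last first.
    have := @free i; have := @free i.+1.
    have := pSS k i; have := pSS k.+1 i; have := pS k i; have := pS k.+1 i.
    by move=> *; case: ifP => *; lia.
  by move=> *; case: ifP => *; lia.
rewrite -big_split /= (eq_bigr (fun i : 'I_N => up i + lo i)) => [|i _]; last first.
  exact: term.
suff shift m : \sum_(i < m) (up i + lo i) + up m
    = \sum_(i < m) (minn (p k.+2 i) j + minn (p k i) j) + minn (p k.+2 m) j.
  have upN : up N = 0 by rewrite /up (gt_row_out b_out gtp) // minn0 min0n.
  have := shift N; rewrite upN (gt_row_out b_out gtp k.+2) // min0n !addn0 => ->.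
  by rewrite big_split.
elim: m => [|m IH]; first by rewrite !big_ord0 /up; lia.
have : lo m + up m.+1 = minn (p k m) j + minn (p k.+2 m.+1) j by rewrite /lo /up; lia.
by rewrite !big_ord_recr /=; move: IH; lia_sums.
Qed.

End Toggle.

Section ToggleWeight.

Variables (n N : nat) (b : nat -> nat).
Hypothesis b_out : forall i, N <= i -> b i = 0.

Lemma letters_right_level p j k : gelfand_tsetlin n b p ->
  letters_right N p j k + \sum_(i < N) (p k i - j) = \sum_(i < N) (p k.+1 i - j).
Proof.
case=> _ _ pS _; rewrite /letters_right -big_split /=.
by apply: eq_bigr => i _; have := pS k i; lia.
Qed.

Lemma cut_level (p : nat -> nat -> nat) j k :
  \sum_(i < N) (p k i - 0)
  = \sum_(i < N) (p k i - j) + \sum_(i < N) minn (p k i) j.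
Proof. by rewrite -big_split; apply: eq_bigr => i _ /=; lia. Qed.

Lemma toggle_weight j k p : gelfand_tsetlin n b p -> column_free j k p ->
  k.+1 < n -> let p' := toggle j k p in
  [/\ letters_right N p' 0 k + letters_right N p j k.+1
      = letters_right N p 0 k.+1 + letters_right N p j k,
      letters_right N p' 0 k.+1 + letters_right N p j k
      = letters_right N p 0 k + letters_right N p j k.+1
    & forall c : nat, c != k -> c != k.+1 ->
        letters_right N p' 0 c = letters_right N p 0 c].
Proof.
move=> gtp free kn p'; have gtp' : gelfand_tsetlin n b p' by apply: toggle_gt.
have other (c : nat) : c != k.+1 -> p' c =1 p c by exact: toggle_other.
have sum_other (c : nat) : c != k.+1 -> \sum_(i < N) (p' c i - 0) = \sum_(i < N) (p c i - 0).
  by move=> ck; apply: eq_bigr => i _; rewrite other.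
have sum_far : \sum_(i < N) (p' k.+1 i - j) = \sum_(i < N) (p k.+1 i - j).
  apply: eq_bigr => i _; have := toggle_beyond j k gtp i.
  by rewrite -/p' /p' toggle_level; case: ifP => ? ?; lia.
suff [-> ->] : letters_right N p' 0 k + letters_right N p j k.+1
      = letters_right N p 0 k.+1 + letters_right N p j k /\
      letters_right N p' 0 k.+1 + letters_right N p j k
      = letters_right N p 0 k + letters_right N p j k.+1.
  split=> // c ck ck1; have := letters_right_level 0 c gtp'.
  have := letters_right_level 0 c gtp.
  by rewrite !sum_other ?eqSS //; lia_sums.
have := toggle_cut_sum b_out gtp free; rewrite -/p'.
have := cut_level p j k; have := cut_level p j k.+1; have := cut_level p j k.+2.
have := cut_level p' j k.+1; rewrite sum_far.
have := letters_right_level j k gtp; have := letters_right_level j k.+1 gtp.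
have := letters_right_level 0 k gtp; have := letters_right_level 0 k.+1 gtp.
have := letters_right_level 0 k gtp'; have := letters_right_level 0 k.+1 gtp'.
rewrite (sum_other k) ?ltn_eqF // (sum_other k.+2) ?gtn_eqF //.
by lia_sums.
Qed.

Lemma letters_right_step p j k : gelfand_tsetlin n b p ->
  letters_right N p j k + \sum_(i < N) (j < p k i)
  = letters_right N p j.+1 k + \sum_(i < N) (j < p k.+1 i).
Proof.
case=> _ _ pS _; rewrite /letters_right -!big_split /=.
by apply: eq_bigr => i _; have := pS k i; lia.
Qed.

(** Reading one more column from the right adds each letter at most once, so a
    first violation is by exactly one, and column [j] then contains [k.+1]
    but not [k]. *)
Lemma first_violation a p j k : gelfand_tsetlin n b p ->
  yamanouchi_at N a p j.+1 k -> ~~ yamanouchi_at N a p j k ->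
  a k.+1 + letters_right N p j k.+1 = (a k + letters_right N p j k).+1
  /\ column_free j k p.
Proof.
rewrite /yamanouchi_at => gtp; have [_ _ pS pSS] := gtp.
have := letters_right_step j k gtp; have := letters_right_step j k.+1 gtp.
have le01 : \sum_(i < N) (j < p k i) <= \sum_(i < N) (j < p k.+1 i).
  by apply: leq_sum => i _; have := pS k i; lia.
have le12 : \sum_(i < N) (j < p k.+2 i) <= (\sum_(i < N) (j < p k.+1 i)).+1.
  case E: N => [|m]; first by rewrite big_ord0.
  rewrite big_ord_recl [X in _ <= X.+1]big_ord_recr /=.
  have : \sum_(i < m) (j < p k.+2 (bump 0 i)) <= \sum_(i < m) (j < p k.+1 i).
    by apply: leq_sum => i _; have := pSS k.+1 i; rewrite /bump /= add1n; lia.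
  by lia_sums.
move: le01 le12 => + + stepk1 stepk yam; rewrite -ltnNge => le01 le12 viol.
split; first by move: le01 le12 stepk1 stepk yam viol; lia_sums.
have eq01 : \sum_(i < N) (j < p k i) = \sum_(i < N) (j < p k.+1 i).
  by move: le01 le12 stepk1 stepk yam viol; lia_sums.
move=> i jp; have iN : i < N.
  by rewrite ltnNge; apply: contraTN jp => /(gt_row_out b_out gtp) ->.
have : \sum_(i < N) ((j < p k.+1 i) - (j < p k i)) = 0.
  rewrite sumnB => [|l _]; first by rewrite eq01 subnn.
  by have := pS k l; lia.
move/eqP; rewrite sum_nat_eq0 => /forallP/(_ (Ordinal iN)) /=.
by rewrite jp; case: ltnP.
Qed.

End ToggleWeight.

(** * Removing a letter from a Littlewood-Richardson array *)

(** A tableau with array [p] whose rows are read on top of [q 0]: [q i] is the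
    content after [i] rows. The last clause is the Yamanouchi condition, and
    [p k.+1 i.+1 <= p k i], kept apart, is column strictness: [p] and [q] obey
    the same inequalities. *)
Definition companion (n : nat) (p q : nat -> nat -> nat) :=
  [/\ forall k i, k <= i -> p k i = 0,
      forall k i, n <= k -> p k i = p n i,
      forall k i, p k i <= p k.+1 i,
      forall i k, p k.+1 i + q i k = p k i + q i.+1 k
    & forall i k, q i.+1 k.+1 <= q i k].

Definition column_strict (p : nat -> nat -> nat) :=
  forall k i, p k.+1 i.+1 <= p k i.

(** Row [t] has just lost a letter [r], so that column strictness may fail by
    one between rows [t] and [t.+1]. At the first failure [k], turning the
    letter [k] of row [t.+1] that causes it into a letter of row [t] repairs
    it, and leaves row [t.+1] with a missing letter [k]. *)
Lemma repair_column_strict n t r p q :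
  companion n p q ->
  (forall k i, i != t -> p k.+1 i.+1 <= p k i) ->
  (forall k, p k.+1 t.+1 <= p k t + (r < k)) ->
  (forall k i, i.+1 = t -> p k.+1 t + (r < k) <= p k i) ->
  exists t' p' q', [/\ companion n p' q', column_strict p', q' 0 =1 q 0,
    forall i, n <= i -> q' i =1 q i
    & forall i, p' n i + (i == t') = p n i + (i == t)].
Proof.
elim: {t}(n - t) {-2}t (leqnn (n - t)) r p q => [|d IH] t dt r p q cpq strict weak slack.
  have [diag stable mono rel qS] := cpq.
  exists t, p, q; split=> // k i; have [->|] := eqVneq i t; last exact: strict.
  have [kt|tk] := leqP k.+1 t.+1; first by rewrite diag.
  have tn : n <= t by lia.
  by rewrite (stable k.+1) ?(stable k) ?[p n t.+1]diag //; lia.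
have [diag stable mono rel qS] := cpq.
have [/existsP[k0 bad0]|none] := boolP [exists k : 'I_n, p k t < p k.+1 t.+1]; last first.
  exists t, p, q; split=> // k i; have [->|] := eqVneq i t; last exact: strict.
  have ok k' : k' < n -> p k'.+1 t.+1 <= p k' t.
    move=> k'n; rewrite leqNgt; apply: contra none => bad.
    by apply/existsP; exists (Ordinal k'n).
  have [kn|nk] := ltnP k n; first exact: ok.
  rewrite stable ?(stable k t) //; last by lia.
  case: n stable ok {nk none IH dt cpq} => [|m] stable ok; first by rewrite diag.
  by apply: leq_trans (ok m _) (mono _ _).
have ex : exists k, p k t < p k.+1 t.+1 by exists (val k0).
case: (ex_minnP ex) => k bad kmin.
have kn : k < n by apply: leq_ltn_trans (kmin _ bad0) (ltn_ord k0).
have {ex k0 bad0}good k' : k' < k -> p k'.+1 t.+1 <= p k' t.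
  by move=> kk; rewrite leqNgt; apply: contraL kk => /kmin; rewrite leqNgt.
have rk : r < k by have := weak k; lia.
have eq_k : p k.+1 t.+1 = (p k t).+1 by have := weak k; rewrite rk; lia.
have tk : t < k by rewrite ltnNge; apply/negP => kt; have := diag k.+1 t.+1 kt; lia.
pose p' k' i := if i == t then p k' t + (k < k')
                else if i == t.+1 then p k' t.+1 - (k < k') else p k' i.
pose q' i k' := q i k' + ((i == t.+1) && (k' == k)).
have pt k' : p' k' t = p k' t + (k < k') by rewrite /p' eqxx.
have pt1 k' : p' k' t.+1 = p k' t.+1 - (k < k').
  by rewrite /p' eqxx gtn_eqF.
have po k' i : i != t -> i != t.+1 -> p' k' i = p k' i.
  by rewrite /p' => /negPf-> /negPf->.
have pos k' : k < k' -> p k.+1 t.+1 <= p k' t.+1.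
  move=> /subnK <-; elim: (k' - k.+1) => // e IHe.
  by rewrite addSn; apply: leq_trans IHe (mono _ _).
have cpq' : companion n p' q'.
  split=> [k' i ki|k' i nk|k' i|i k'|i k'].
  - have [Ei|ne] := eqVneq i t; first by rewrite Ei pt diag; lia.
    have [Ei|ne'] := eqVneq i t.+1; first by rewrite Ei pt1 diag; lia.
    by rewrite po // diag.
  - have [->|ne] := eqVneq i t.
      by rewrite !pt (stable k') //; have := kn; lia.
    have [->|ne'] := eqVneq i t.+1.
      by rewrite !pt1 (stable k') //; have := kn; lia.
    by rewrite !po // stable.
  - have [->|ne] := eqVneq i t; first by rewrite !pt; have := mono k' t; lia.
    have [->|ne'] := eqVneq i t.+1; last by rewrite !po.
    rewrite !pt1; have := mono k' t.+1.
    have [-> _|] := eqVneq k' k; last by lia.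
    case: (k) good rk eq_k => // k1 good _ eq_k.
    by have := good k1 (leqnn _); have := mono k1 t; lia.
  - rewrite /q'; have := rel i k'.
    have [->|ne] := eqVneq i t; first by rewrite !pt eqxx ltn_eqF //=; case: eqP; lia.
    have [->|ne'] := eqVneq i t.+1.
      rewrite !pt1 [t.+2 == _]gtn_eqF //=.
      have := pos k'; have := pos k'.+1; have := eq_k.
      by have [->|] := eqVneq k' k; lia.
    by rewrite !po // eqSS (negPf ne) /= !addn0.
  rewrite /q' eqSS; have := qS i k'.
  have [->|ne] /= := eqVneq i t; last by lia.
  have [E|] /= := eqVneq k'.+1 k; last by lia.
  (* Row t.+1 has more letters k than row t has letters k.-1. *)
  have := good k'; have := mono k' t; have := rel t k'; have := rel t.+1 k'.+1.
  by have := qS t.+1 k'; rewrite -E in eq_k *; rewrite ltn_eqF //; lia.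
have [||||t' [pf [qf [cf sf q0 qn rows]]]] := IH t.+1 _ k p' q' cpq'.
- have := dt; have := kn; have := tk; lia.
- move=> k' i ne; have [Ei|ne'] := eqVneq i t; last first.
    have [Ei|ne''] := eqVneq i.+1 t; last by rewrite !po //; exact: strict.
    rewrite Ei pt po -?Ei; last first.
    + by lia.
    + by lia.
    have := slack k' i Ei; rewrite Ei; have := rk; case: ltnP; lia.
  rewrite Ei pt pt1; have [kk|kk] := ltnP k' k; first by have := good k' kk; lia.
  have [->|nk] := eqVneq k' k; first by lia.
  by have := weak k'; lia.
- move=> k'; rewrite pt1 po; try lia.
  by have := strict k' t.+1; rewrite gtn_eqF // => /(_ isT); lia.
- move=> k' i [->]; rewrite pt pt1.
  have [kk|kk] := ltnP k' k; first by have := good k' kk; lia.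
  have [->|nk] := eqVneq k' k; first by lia.
  by have := weak k'; lia.
exists t', pf, qf; split=> // [k'|i ni k'|i].
- by rewrite q0 /q' addn0.
- by rewrite qn // /q' gtn_eqF ?addn0 //; lia.
rewrite rows; have [->|ne] := eqVneq i t.
  by rewrite pt kn ltn_eqF //; lia.
have [->|ne'] := eqVneq i t.+1; last by rewrite po.
by rewrite pt1 kn; have := pos n kn; lia.
Qed.

(** If the reading starts with one more box in row [r], dropping the first letter
    [r] that is read restores the contents from there on; before it, the new box
    fits because it sits in a corner. Only column strictness may suffer. *)
Lemma remove_letter n p q r : companion n p q -> column_strict p ->
  (forall k, r = k.+1 -> q 0 r < q 0 k) -> q 0 r < q n r ->
  exists t p' q', [/\ companion n p' q', column_strict p',
    forall k, q' 0 k = q 0 k + (k == r),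
    forall i, n <= i -> q' i =1 q i & forall i, p' n i + (i == t) = p n i].
Proof.
move=> cpq strict r_corner r_room; have [diag stable mono rel qS] := cpq.
have q_mono i k : q i k <= q i.+1 k by have := rel i k; have := mono k i; lia.
have q0_le i k : q 0 k <= q i k by elim: i => // i IHi; apply: leq_trans IHi _.
have ex : exists i, q 0 r < q i.+1 r.
  by case: n r_room {cpq stable} => [|m]; [rewrite ltnn | exists m].
have tn : exists2 t, t < n & q 0 r < q t.+1 r.
  by case: n r_room {cpq stable} => [|m] h; [rewrite ltnn in h | exists m].
case: (ex_minnP ex) => t t_r t_min.
have {tn} tn : t < n by case: tn => m mn /t_min; lia.
have q_t i : i <= t -> q i r = q 0 r.
  case: i => // i it; apply/eqP; rewrite eqn_leq q0_le andbT leqNgt.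
  by apply/negP => /t_min; lia.
have p_pos k : r < k -> p r t < p k t.
  move=> rk; have : p r t < p r.+1 t by have := rel t r; rewrite q_t //; lia.
  move=> h; apply: leq_trans h _; rewrite -(subnK rk).
  by elim: (k - r.+1) => // d IH; rewrite addSn; apply: leq_trans IH (mono _ _).
pose p1 k i := p k i - ((i == t) && (r < k)).
pose q1 i k := q i k + ((k == r) && (i <= t)).
have cpq1 : companion n p1 q1.
  split=> [k i ki|k i nk|k i|i k|i k]; rewrite /p1 /q1.
  - by rewrite diag.
  - rewrite (stable k) //; case: eqP => //= ->.
    have [rn|nr] := ltnP r n; first by rewrite (leq_trans rn nk).
    by have := p_pos r.+1 (leqnn _); rewrite !(stable r, stable r.+1) ?ltnn //; lia.
  - have := mono k i; case: eqP => [->|] /=; last by lia.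
    by have := p_pos k.+1; have [->|] := eqVneq k r; lia.
  - have := rel i k; have := p_pos k; have := p_pos k.+1.
    have [->|ne] /= := eqVneq i t.
      by rewrite leqnn ltnn andbF andbT; case: eqP => [->|]; lia.
    by have -> : (i < t) = (i <= t); [lia | case: eqP; lia].
  have := qS i k; have [E|] /= := eqVneq k.+1 r; last by lia.
  have [it|] /= := leqP i.+1 t; last by lia.
  have := r_corner k (esym E); have := q_t i.+1 it; have := q0_le i k.
  by rewrite E; lia.
have [| | |t' [p' [q' [c' s' q0' qn' rows]]]] :=
    @repair_column_strict n t r p1 q1 cpq1.
- move=> k i ne; rewrite /p1 (negPf ne) /= subn0.
  by apply: leq_trans (leq_subr _ _) (strict _ _).
- by move=> k; rewrite /p1 eqxx gtn_eqF //=; have := strict k t; lia.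
- move=> k i Ei; rewrite /p1 eqxx -Ei ltn_eqF //=.
  by have := strict k i; rewrite Ei; have := p_pos k.+1; lia.
exists t', p', q'; split=> // [k|i ni k|i].
- by rewrite q0' /q1 andbT.
- by rewrite qn' // /q1 [i <= t]leqNgt (leq_trans tn ni) andbF addn0.
rewrite rows /p1; have [->|] //= := eqVneq i t; last by rewrite subn0 addn0.
have [rn|nr] := ltnP r n; first by rewrite subnK //; have := p_pos n rn; lia.
by have := p_pos r.+1 (leqnn _); rewrite !(stable r, stable r.+1) ?ltnn //; lia.
Qed.

(** * Tableaux and arrays *)

Lemma count_initial_segment (a : pred nat) L :
  (forall x y, x <= y -> y < L -> a y -> a x) ->
  forall j, j < L -> a j = (j < count a (iota 0 L)).
Proof.
elim: L => // L IH a_down j; have -> : iota 0 L.+1 = iota 0 L ++ [:: L].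
  by rewrite -addn1 iotaD add0n.
rewrite count_cat /= addn0 ltnS.
have {}IH := IH (fun x y xy yL => a_down x y xy (ltnW yL)).
have [aL jL|naL] := boolP (a L).
  have -> : count a (iota 0 L) = L.
    rewrite -[RHS](size_iota 0 L); apply/eqP; rewrite -all_count.
    by apply/allP => x; rewrite mem_iota => /andP[_ xL]; apply: a_down aL; lia.
  by rewrite addn1 ltnS jL; apply: a_down aL.
rewrite addn0 leq_eqVlt => /predU1P[->|/IH //]; rewrite (negPf naL).
by apply/esym/negbTE; rewrite -leqNgt -{2}(size_iota 0 L) count_size.
Qed.

Lemma part_antitone l : is_part l -> forall i, nth 0 l i.+1 <= nth 0 l i.
Proof.
case/andP=> sl _ i; have [lt_i|] := ltnP i.+1 (size l); last by move/(nth_default 0)->.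
exact: (sortedP 0 sl).
Qed.

Section Tableaux.

Variables (n : nat) (l : seq nat).
Hypothesis l_part : is_part l.
Implicit Type T : {ffun young l -> 'I_n}.

Definition entry T i j : nat :=
  if insub (i, j) : option (young l) is Some c then T c : nat else n.

Definition tab_array T k i : nat :=
  count (fun j => entry T i j < k) (iota 0 (nth 0 l i)).

Lemma entryE T (c : young l) : entry T (val c).1 (val c).2 = T c.
Proof. by rewrite /entry -surjective_pairing valK. Qed.

Lemma entry_in T i j : j < nth 0 l i ->
  exists2 c : young l, val c = (i, j) & entry T i j = T c.
Proof.
rewrite -in_young => ij; exists [` ij]%fset => //.
by rewrite -entryE.
Qed.

Lemma ssyt_row T : is_ssyt T -> forall i j j', j <= j' -> j' < nth 0 l i ->
  entry T i j <= entry T i j'.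
Proof.
move=> /forallP ssT i j j' jj j'l.
have [c' Ec' ->] := entry_in T j'l.
have [c Ec ->] := entry_in T (leq_ltn_trans jj j'l).
have /forallP/(_ c')/andP[] := ssT c.
by rewrite Ec Ec' /= eqxx jj.
Qed.

Lemma ssyt_column T : is_ssyt T -> forall i j, j < nth 0 l i.+1 ->
  entry T i j < entry T i.+1 j.
Proof.
move=> /forallP ssT i j jl.
have [c' Ec' ->] := entry_in T jl.
have [c Ec ->] := entry_in T (leq_trans jl (part_antitone l_part i)).
have /forallP/(_ c')/andP[_] := ssT c.
by rewrite Ec Ec' /= eqxx ltnSn.
Qed.

Lemma tab_array_le T k i : tab_array T k i <= nth 0 l i.
Proof. by rewrite (leq_trans (count_size _ _)) ?size_iota. Qed.

Lemma entry_lt T : is_ssyt T -> forall i j k, j < nth 0 l i ->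
  (entry T i j < k) = (j < tab_array T k i).
Proof.
move=> ssT i j k jl; rewrite /tab_array.
apply: (count_initial_segment (a := fun j => entry T i j < k)) => // x y xy yl.
exact: leq_ltn_trans (ssyt_row ssT xy yl).
Qed.

Lemma tab_array_gt T : is_ssyt T -> gelfand_tsetlin n (nth 0 l) (tab_array T).
Proof.
move=> ssT; split=> [i|k i nk|k i|k i].
- by rewrite /tab_array (eq_count (a2 := pred0)) ?count_pred0.
- rewrite -[RHS](size_iota 0); apply/eqP; rewrite -all_count.
  apply/allP => j; rewrite mem_iota => /andP[_ jl].
  by have [c _ ->] := entry_in T jl; apply: leq_trans nk.
- by apply: sub_count => j /= /leqW.
rewrite leqNgt; apply/negP => lt.
have jl := leq_trans lt (tab_array_le _ _ _).
move: lt; rewrite -entry_lt // ltnS => le_k.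
have := leq_trans (ssyt_column ssT jl) le_k.
by rewrite entry_lt ?ltnn //; apply: leq_trans jl (part_antitone l_part i).
Qed.

(** The entry of the box [(i, j)] is the number of letters [k] such that row
    [i] has at most [j] entries [<= k]; [T0] only serves to have a letter at
    hand. *)
Definition of_array (T0 : {ffun young l -> 'I_n}) (p : nat -> nat -> nat) :
    {ffun young l -> 'I_n} :=
  [ffun c => insubd (T0 c)
     (count (fun k => p k.+1 (val c).1 <= (val c).2) (iota 0 n))].

Lemma of_array_lt T0 p : gelfand_tsetlin n (nth 0 l) p ->
  forall c k, (of_array T0 p c < k) = ((val c).2 < p k (val c).1).
Proof.
move=> gtp [[i j] ij] k; rewrite ffunE /=.
have jl : j < nth 0 l i by rewrite -in_young.
have [p0 pn _ _] := gtp.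
set v := count _ _.
have vE k' : k' < n -> (k' < v) = (p k'.+1 i <= j).
  move=> k'n; rewrite /v -count_initial_segment // => x y xy _.
  exact: leq_trans (gt_mono gtp _ _).
have vn : v < n.
  have n_gt0 : 0 < n.
    by rewrite lt0n; apply: contraTneq jl => n0; rewrite -leqNgt -(pn 0) ?n0 // p0.
  have := vE n.-1; rewrite prednK // pn // leqnn => /(_ isT).
  by rewrite [_ <= j]leqNgt jl /= => /negbT; lia.
rewrite val_insubd vn; case: k => [|k]; first by rewrite p0.
have [kn|nk] := ltnP k n; first by rewrite ltnS leqNgt vE // -ltnNge.
by rewrite pn ?jl //; [apply/esym; lia | lia].
Qed.

Lemma of_array_ssyt T0 p : gelfand_tsetlin n (nth 0 l) p ->
  is_ssyt (of_array T0 p).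
Proof.
move=> gtp; have [_ _ _ pSS] := gtp.
apply/forallP => c; apply/forallP => c'; apply/andP; split; apply/implyP.
  case/andP=> /eqP row le_c.
  have := ltnSn (of_array T0 p c'); rewrite (of_array_lt T0 gtp c').
  by rewrite -row -[of_array T0 p c <= _]ltnS (of_array_lt T0 gtp c); apply: leq_ltn_trans le_c.
case/andP=> /eqP col lt_c.
rewrite of_array_lt // col.
have := ltnSn (of_array T0 p c'); rewrite (of_array_lt T0 gtp c').
move=> /leq_trans; apply.
case E : (val c').1 lt_c => [//|i]; rewrite ltnS => le_i.
by apply: leq_trans (pSS _ _) (gt_anti gtp _ le_i).
Qed.

Lemma tab_array_of_array T0 p : gelfand_tsetlin n (nth 0 l) p ->
  tab_array (of_array T0 p) =2 p.
Proof.
move=> gtp k i; have ssT := of_array_ssyt T0 gtp.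
have same j : j < nth 0 l i -> (j < tab_array (of_array T0 p) k i) = (j < p k i).
  move=> jl; rewrite -entry_lt //; have [c Ec ->] := entry_in (of_array T0 p) jl.
  by rewrite of_array_lt // Ec.
have le1 := tab_array_le (of_array T0 p) k i; have le2 := gt_le_shape gtp k i.
apply/eqP; rewrite eqn_leq; apply/andP; split; rewrite leqNgt; apply/negP => lt.
  by have := same (p k i) (leq_trans lt le1); rewrite lt ltnn.
by have := same _ (leq_trans lt le2); rewrite lt ltnn.
Qed.

Lemma of_arrayK T0 T : is_ssyt T -> of_array T0 (tab_array T) = T.
Proof.
move=> ssT; apply/ffunP => c; apply/val_inj.
have same k : (of_array T0 (tab_array T) c < k) = (T c < k).
  rewrite of_array_lt; last exact: tab_array_gt.
  rewrite -entry_lt ?entryE //.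
  by rewrite -in_young -surjective_pairing; apply: valP.
by apply/eqP; rewrite eqn_leq -ltnS same ltnSn /= -ltnS -same ltnSn.
Qed.

Lemma eq_of_array T0 p p' : p =2 p' -> of_array T0 p = of_array T0 p'.
Proof.
by move=> pp; apply/ffunP => c; rewrite !ffunE; congr insubd; apply: eq_count => k; rewrite pp.
Qed.

Definition weight T : 'X_{1..n} := (\sum_(c : young l) U_(T c))%MM.

Lemma sum_young (F : nat * nat -> nat) :
  \sum_(c : young l) F (val c) =
  \sum_(i < size l) \sum_(j <- iota 0 (nth 0 l i)) F (val i, j).
Proof.
rewrite -(big_seq_fsetE addn (young l) xpredT F) /=.
rewrite (perm_big [seq (i, j) | i <- iota 0 (size l), j <- iota 0 (nth 0 l i)]).
  rewrite big_allpairs_dep.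
  by rewrite -(big_mkord xpredT (fun i => \sum_(j <- iota 0 (nth 0 l i)) F (i, j)))
    /index_iota subn0.
apply: uniq_perm => [||c]; first exact: fset_uniq.
  by apply: allpairs_uniq_dep => [|i _|[a b] [c d] _ _ /= [-> ->]//]; exact: iota_uniq.
by rewrite -[LHS]/(c \in young l) in_fset.
Qed.

Lemma sum_tab_array T N k : size l <= N ->
  \sum_(i < N) tab_array T k i = \sum_(c : young l) (T c < k).
Proof.
move=> lN; transitivity (\sum_(c : young l) (entry T (val c).1 (val c).2 < k)); last first.
  by apply: eq_bigr => c _; rewrite entryE.
rewrite (sum_young (fun c => entry T c.1 c.2 < k : nat)) /=.
rewrite -(subnKC lN) big_split_ord /= [X in _ + X]big1 ?addn0 => [|i _]; last first.
  by rewrite /tab_array nth_default ?leq_addr.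
by apply: eq_bigr => i _; rewrite /tab_array -sum1_count big_mkcond.
Qed.

Lemma weightE T N (k : 'I_n) : size l <= N -> is_ssyt T ->
  weight T k = letters_right N (tab_array T) 0 k.
Proof.
move=> lN /tab_array_gt gtT; have := letters_right_level N 0 k gtT.
have sub0 m : \sum_(i < N) (tab_array T m i - 0) = \sum_(c : young l) (T c < m).
  by rewrite -(sum_tab_array T m lN); apply: eq_bigr => i _; rewrite subn0.
have -> : weight T k = \sum_(c : young l) (T c == k).
  by rewrite /weight mnm_sumE; apply: eq_bigr => c _; rewrite mnm1E.
rewrite !sub0 => E; apply/eqP; rewrite -(eqn_add2r (\sum_(c : young l) (T c < k))) E.
by rewrite -big_split /=; apply/eqP/eq_bigr => c _; rewrite -val_eqE /=; lia.
Qed.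

Lemma schurE : schur n l = (\sum_(T : {ffun young l -> 'I_n} | is_ssyt T) 'X_[weight T])%R.
Proof.
apply: eq_bigr => T _; rewrite /weight.
by rewrite (big_morph _ (@mpolyXD n _) (mpolyX0 n _)).
Qed.

End Tableaux.

(** * Alternants *)

Import GRing.Theory Num.Theory Order.TTheory.

Section Alternants.

Local Open Scope ring_scope.

Variable n : nat.
Implicit Types (m g : 'X_{1..n}) (s t : 'S_n) (i j : 'I_n).

Local Notation "m # s" := [multinom m (s i) | i < n]
  (at level 40, left associativity).

Definition alternant m : {mpoly int[n]} := \sum_(s : 'S_n) (-1) ^+ s *: 'X_[m # s].

Lemma alternant_tperm m i j : i != j -> alternant (m # (tperm i j)) = - alternant m.
Proof.
move=> ij; rewrite /alternant -sumrN.
rewrite [RHS](reindex_inj (mulIg (tperm i j))) /=; apply: eq_bigr => s _.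
rewrite odd_permM odd_tperm ij addbT signrN scaleNr opprK.
by congr (_ *: 'X_[_]); apply/mnmP => k; rewrite !mnmE permM.
Qed.

Lemma alternant_eq0 m i j : i != j -> m i = m j -> alternant m = 0.
Proof.
move=> ij mij; have := alternant_tperm m ij.
have -> : m # (tperm i j) = m.
  by apply/mnmP => k; rewrite mnmE; case: tpermP => // ->.
move=> E; apply/mpolyP => g; rewrite mcoeff0.
have : (alternant m)@_g = - (alternant m)@_g by rewrite {1}E mcoeffN.
by lia.
Qed.

(** A permutation sorting a weakly decreasing [m] into a strictly decreasing
    [g] preserves the order, hence is the identity. *)
Lemma alternant_coeff m g :
  (forall i j, (i <= j)%N -> (m j <= m i)%N) ->
  (forall i j, (i < j)%N -> (g j < g i)%N) ->
  (alternant m)@_g = (m == g)%:R.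
Proof.
move=> m_anti g_strict; rewrite /alternant raddf_sum /=.
have id_only s : m # s = g -> s = 1%g.
  move=> /mnmP ms; have s_mono i j : (i < j)%N -> (s i < s j)%N.
    move=> ij; rewrite ltnNge; apply/negP => /m_anti; rewrite leqNgt.
    by have := g_strict i j ij; rewrite -!ms !mnmE => ->.
  have ge i : (i <= s i)%N.
    case: i => k kn; elim: k kn => // k IH kn.
    have kn' : (k < n)%N by apply: ltnW.
    by apply: leq_ltn_trans (IH kn') _; apply: s_mono.
  have le i : (s i <= i)%N.
    have [k] := ubnP (n - i); elim: k i => // k IH i ik.
    have [ni|ni] := ltnP i.+1 n; last by have := ltn_ord (s i); lia.
    have h := IH (Ordinal ni); rewrite /= in h.
    have := s_mono i (Ordinal ni) (ltnSn _); have := h; lia.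
  by apply/permP => i; rewrite perm1; apply/val_inj/eqP; rewrite eqn_leq ge le.
rewrite (bigD1 1%g) //= big1 ?addr0 => [|s s1].
  rewrite mcoeffZ mcoeffX odd_perm1 expr0 mul1r; congr (_ == _)%:R.
  by apply/mnmP => k; rewrite mnmE perm1.
rewrite mcoeffZ mcoeffX; case: eqP => [/id_only E|_]; last by rewrite mulr0.
by rewrite E eqxx in s1.
Qed.

Lemma alternant_mul_sym (I : finType) (P : pred I) (w : I -> 'X_{1..n}) m :
  (forall s, \sum_(x | P x) 'X_[w x # s] = \sum_(x | P x) 'X_[w x] :> {mpoly int[n]}) ->
  alternant m * (\sum_(x | P x) 'X_[w x]) = \sum_(x | P x) alternant (m + w x)%MM.
Proof.
move=> sym; rewrite /alternant [RHS]exchange_big mulr_suml; apply: eq_bigr => s _.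
rewrite -(sym s) -scalerAl mulr_sumr -scaler_sumr; congr (_ *: _).
apply: eq_bigr => x _; rewrite -mpolyXD; congr 'X_[_].
by apply/mnmP => k; rewrite !mnmE.
Qed.

(* Adjacent transpositions generate the symmetric group. *)
Lemma issym_adjacent (p : {mpoly int[n]}) :
  (forall i j, j = i.+1 :> nat -> msym (tperm i j) p = p) ->
  forall s, msym s p = p.
Proof.
move=> adj.
have tp i j : (i < j)%N -> msym (tperm i j) p = p.
  case: j => k kn /=; elim: k kn => // k IH kn.
  rewrite ltnS leq_eqVlt => /predU1P[ik|ik]; first by apply: adj; rewrite ik.
  have kn' : (k < n)%N by apply: ltnW.
  have -> : tperm i (Ordinal kn) =
      (tperm i (Ordinal kn') ^ tperm (Ordinal kn') (Ordinal kn))%g.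
    rewrite tpermJ tpermL tpermD //; apply/eqP => /(congr1 val) /= E; lia.
  have adjk : msym (tperm (Ordinal kn') (Ordinal kn)) p = p by apply: adj.
  by rewrite conjgE tpermV !msymMm adjk IH.
move=> s; have [ts -> _] := prod_tpermP s.
elim: ts => [|[i j] ts IH]; first by rewrite big_nil msym1m.
rewrite big_cons msymMm /=; have [->|ij] := eqVneq i j; first by rewrite tperm1 msym1m.
have [lt|gt|/val_inj E] := ltngtP i j; last by rewrite E eqxx in ij.
  by rewrite tp.
by rewrite tpermC tp.
Qed.

Definition nabla (p : {mpoly int[n]}) : {mpoly int[n]} := \sum_i p^`M(i).

Lemma nablaM p q : nabla (p * q) = nabla p * q + p * nabla q.
Proof.
rewrite /nabla mulr_suml mulr_sumr -big_split; apply: eq_bigr => i _ /=.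
exact: mderivM.
Qed.

Lemma nabla_sum (I : Type) (r : seq I) (P : pred I) F :
  nabla (\sum_(x <- r | P x) F x) = \sum_(x <- r | P x) nabla (F x).
Proof. by rewrite /nabla [RHS]exchange_big; apply: eq_bigr => i _; rewrite raddf_sum. Qed.

Lemma nablaZ c p : nabla (c *: p) = c *: nabla p.
Proof. by rewrite /nabla scaler_sumr; apply: eq_bigr => i _; rewrite mderivZ. Qed.

Lemma nabla_alternant m : nabla (alternant m) = \sum_i (m i)%:R *: alternant (m - U_(i))%MM.
Proof.
rewrite /alternant nabla_sum; under [RHS]eq_bigr do rewrite scaler_sumr.
rewrite [RHS]exchange_big; apply: eq_bigr => s _ /=.
rewrite nablaZ /nabla [RHS](reindex_inj (@perm_inj _ s)) /= scaler_sumr.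
apply: eq_bigr => i _; rewrite mderivX mnmE !scalerA mulrC; congr (_ *: 'X_[_]).
by apply/mnmP => k; rewrite !mnmE (inj_eq perm_inj).
Qed.

End Alternants.

(** * Products of an alternant and a Schur polynomial *)

Lemma eq_letters_right N p p' : p =2 p' -> letters_right N p =2 letters_right N p'.
Proof. by move=> pp j k; apply: eq_bigr => i _; rewrite !pp. Qed.

Section AlternantSchur.

Variables (n : nat) (l : seq nat).
Hypothesis l_part : is_part l.

Local Notation tableau := {ffun young l -> 'I_n}.
Implicit Type T : tableau.
Local Notation D T := (letters_right (size l) (tab_array T)).

Let l_out i : size l <= i -> nth 0 l i = 0.
Proof. exact: nth_default. Qed.

Definition bender_knuth (j k : nat) T : tableau :=
  of_array T (toggle j k (tab_array T)).

Section Involution.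

Variables (j k : nat) (T : tableau).
Hypotheses (ssT : is_ssyt T) (free : column_free j k (tab_array T)) (kn : k.+1 < n).

Let gtT := tab_array_gt l_part ssT.
Let gtT' := toggle_gt gtT free kn.

Lemma bender_knuth_ssyt : is_ssyt (bender_knuth j k T).
Proof. exact: of_array_ssyt. Qed.

Lemma tab_array_bender_knuth :
  tab_array (bender_knuth j k T) =2 toggle j k (tab_array T).
Proof. exact: tab_array_of_array. Qed.

Lemma bender_knuthK : bender_knuth j k (bender_knuth j k T) = T.
Proof.
rewrite /bender_knuth -/(bender_knuth j k T).
have same : toggle j k (tab_array (bender_knuth j k T)) =2 tab_array T.
  move=> k' i; rewrite -(toggleK j k gtT k' i) /toggle !tab_array_bender_knuth.
  by case: i => [|i] //; rewrite tab_array_bender_knuth.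
by rewrite (eq_of_array _ same) of_arrayK.
Qed.

Lemma bender_knuth_letters_right j' c : j <= j' ->
  D (bender_knuth j k T) j' c = D T j' c.
Proof.
by move=> jj; rewrite (eq_letters_right _ tab_array_bender_knuth) (toggle_letters_right _ _ gtT).
Qed.

Lemma bender_knuth_weight (i i' : 'I_n) : i = k :> nat -> i' = k.+1 :> nat ->
  let T' := bender_knuth j k T in
  [/\ weight T' i + D T j k.+1 = weight T i' + D T j k,
      weight T' i' + D T j k = weight T i + D T j k.+1
    & forall c : 'I_n, c != i -> c != i' -> weight T' c = weight T c].
Proof.
move=> ik ik' T'; rewrite !(@weightE _ _ l_part _ (size l)) //; try exact: bender_knuth_ssyt.
rewrite ik ik' !(eq_letters_right _ tab_array_bender_knuth).
have [-> -> other] := toggle_weight l_out gtT free kn; split=> // c ci ci'.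
rewrite !(@weightE _ _ l_part _ (size l)) //; try exact: bender_knuth_ssyt.
rewrite (eq_letters_right _ tab_array_bender_knuth) other //.
  by rewrite -ik.
by rewrite -ik'.
Qed.

End Involution.

Lemma letters_right_far T j c : is_ssyt T -> nth 0 l 0 <= j -> D T j c = 0.
Proof.
move=> ssT lj; rewrite /letters_right big1 // => i _.
have := tab_array_le T c.+1 i; have := tab_array_le T c i.
suff : nth 0 l i <= nth 0 l 0 by lia.
elim: (val i) => // m IH; exact: leq_trans (part_antitone l_part m) IH.
Qed.

Lemma column_free_far T j k : is_ssyt T -> nth 0 l 0 <= j ->
  column_free j k (tab_array T).
Proof.
move=> ssT lj i; have := gt_anti (tab_array_gt l_part ssT) k.+1 (leq0n i).
by have := tab_array_le T k.+1 0; lia.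
Qed.

Lemma weight_tperm (w w' : 'X_{1..n}) (i i' : 'I_n) :
  w' i = w i' -> w' i' = w i -> (forall c, c != i -> c != i' -> w' c = w c) ->
  w' = [multinom w (tperm i i' c) | c < n].
Proof.
move=> e1 e2 e3; apply/mnmP => c; rewrite mnmE.
by case: tpermP => [->|->|/eqP ci /eqP ci'] //; apply: e3.
Qed.

(** Cutting beyond the last column exchanges the weights of adjacent letters. *)
Lemma schur_sym s : msym s (schur n l) = schur n l.
Proof.
apply: issym_adjacent => i i' ii'; rewrite schurE // raddf_sum /=.
set j := nth 0 l 0; pose f := bender_knuth j i.
have fP T : is_ssyt T -> [/\ is_ssyt (f T), f (f T) = T &
    weight (f T) = [multinom weight T (tperm i i' c) | c < n]].
  move=> ssT; have free : column_free j i (tab_array T) by apply: column_free_far.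
  have kn : i.+1 < n by rewrite -ii'.
  split; [exact: bender_knuth_ssyt|exact: bender_knuthK|].
  have [] := bender_knuth_weight ssT free kn (erefl (i : nat)) ii'.
  rewrite !letters_right_far // !addn0 => e1 e2 e3.
  exact: weight_tperm.
rewrite [RHS](reindex_onto f f) => [|T /fP[]//].
apply: eq_big => [T|T /fP[_ _ ->]]; last by rewrite msymX tpermV.
apply/idP/andP => [/fP[-> -> _]//|[/fP[+ + _] /eqP ffT]].
by rewrite ffT.
Qed.

Lemma weight_sum_sym (s : 'S_n) :
  (\sum_(T : tableau | is_ssyt T) 'X_[[multinom weight T (s c) | c < n]]
   = \sum_(T : tableau | is_ssyt T) 'X_[weight T] :> {mpoly int[n]})%R.
Proof.
rewrite -[RHS]schurE // -(schur_sym s^-1) schurE // raddf_sum /=.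
by apply: eq_bigr => T _; rewrite msymX invgK.
Qed.

Variable a : seq nat.
Hypothesis a_part : is_part a.

Definition staircase : 'X_{1..n} := [multinom n.-1 - i | i < n].
Definition exponent (b : seq nat) : 'X_{1..n} := [multinom nth 0 b i | i < n].

Definition yamanouchi T : bool :=
  [forall j : 'I_(nth 0 l 0), forall k : 'I_n,
    (k.+1 < n) ==> yamanouchi_at (size l) (nth 0 a) (tab_array T) j k].

Local Notation term T := (alternant (exponent a + staircase + weight T)%MM).

Definition violation T (jk : 'I_(nth 0 l 0) * 'I_n) : bool :=
  (jk.2.+1 < n) && ~~ yamanouchi_at (size l) (nth 0 a) (tab_array T) jk.1 jk.2.

(** The choice of the violation only depends on the columns [>= j], which the
    involution applied to the columns [< j] fixes. *)
Definition first_bad T jk : bool :=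
  [&& violation T jk,
      [forall jk' : 'I_(nth 0 l 0) * 'I_n, (jk.1 < jk'.1) ==> ~~ violation T jk']
    & [forall k : 'I_n, (k < jk.2) ==> ~~ violation T (jk.1, k)]].

Lemma first_bad_unique T jk jk' : first_bad T jk -> first_bad T jk' -> jk = jk'.
Proof.
case: jk jk' => j k [j' k'] /and3P[v /forallP nj /forallP nk].
case/and3P=> v' /forallP nj' /forallP nk'.
have [lt|gt|/val_inj E] := ltngtP j j'.
- by have := nj (j', k'); rewrite /= lt v'.
- by have := nj' (j, k); rewrite /= gt v.
rewrite -{}E in v' nj' nk' *.
have [lt|gt|/val_inj -> //] := ltngtP k k'.
- by have := nk' k; rewrite /= lt v.
- by have := nk k'; rewrite /= gt v'.
Qed.

Lemma exists_first_bad T : ~~ yamanouchi T -> exists jk, first_bad T jk.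
Proof.
case/forallPn=> j0 /forallPn[k0]; rewrite negb_imply => v0.
have v00 : violation T (j0, k0) := v0.
pose bad j := [exists k, violation T (j, k)].
have bad0 : bad j0 by apply/existsP; exists k0.
case: (arg_maxnP (fun j : 'I_(nth 0 l 0) => j : nat) bad0) => j /existsP[k1 v1] jmax.
case: (@arg_minnP _ k1 (fun k => violation T (j, k)) (fun k => k : nat) v1) => k vk kmin.
exists (j, k); apply/and3P; split=> //.
  apply/forallP => -[j' k']; apply/implyP => /= jj'; apply: contraL jj' => v'.
  by rewrite -leqNgt; apply: jmax; apply/existsP; exists k'.
by apply/forallP => k'; apply/implyP; rewrite /= ltnNge; apply: contra => /kmin.
Qed.

Lemma first_bad_toggle T (j : 'I_(nth 0 l 0)) (k : 'I_n) : is_ssyt T ->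
  first_bad T (j, k) -> let T' := bender_knuth j k T in
  [/\ is_ssyt T', first_bad T' (j, k), bender_knuth j k T' = T
    & term T' = (- term T)%R].
Proof.
move=> ssT bad T'; have /and3P[/andP[/= kn vio] /forallP nj /forallP nk] := bad.
have gtT := tab_array_gt l_part ssT.
have next : yamanouchi_at (size l) (nth 0 a) (tab_array T) j.+1 k.
  have [jl|lj] := ltnP j.+1 (nth 0 l 0); last first.
    by rewrite /yamanouchi_at !letters_right_far // !addn0 part_antitone.
  by have := nj (Ordinal jl, k); rewrite /violation /= ltnSn kn /= negbK.
have [over free] := first_violation l_out gtT next vio.
have ssT' : is_ssyt T' by exact: bender_knuth_ssyt.
split=> //; last 2 first.
- exact: bender_knuthK.
- pose k' := Ordinal kn; have kk' : k != k'.
    by apply/eqP => /(congr1 val) /=; lia.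
  rewrite -(alternant_tperm _ kk'); congr alternant.
  have [e1 e2 e3] := bender_knuth_weight ssT free kn erefl (erefl (k' : nat)).
  rewrite -/T' in e1 e2 e3.
  apply: weight_tperm => [||c ck ck']; last by rewrite !mnmDE e3.
  + by rewrite !mnmDE !mnmE /=; move: e1 e2 over; rewrite /k' /=; lia.
  + by rewrite !mnmDE !mnmE /=; move: e1 e2 over; rewrite /k' /=; lia.
have same (jk : 'I_(nth 0 l 0) * 'I_n) : j <= jk.1 -> violation T' jk = violation T jk.
  by move=> jj; rewrite /violation /yamanouchi_at !bender_knuth_letters_right.
apply/and3P; split; first by rewrite same //; case/and3P: bad.
  apply/forallP => jk; apply/implyP => /= lt; rewrite same ?(ltnW lt) //.
  by have := nj jk; rewrite /= lt.
by apply/forallP => k'; rewrite same //; exact: nk.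
Qed.

(** The tableaux that are not Yamanouchi on top of [a] cancel in pairs: applying
    the Bender-Knuth involution to the columns left of the first violation
    exchanges two exponents of the alternant. *)
Lemma alternant_mul_schur :
  (alternant (exponent a + staircase)%MM * schur n l
   = \sum_(T : tableau | is_ssyt T && yamanouchi T) term T)%R.
Proof.
rewrite schurE // alternant_mul_sym; last exact: weight_sum_sym.
rewrite (bigID yamanouchi) /= [X in (_ + X)%R](_ : _ = 0%R) ?addr0 //.
transitivity (\sum_(T : tableau | is_ssyt T)
    \sum_(jk | first_bad T jk) term T)%R.
  rewrite big_mkcondr; apply: eq_bigr => T ssT /=.
  case: ifP => [nyam|/negbFE yam].
    have [jk bad] := exists_first_bad nyam.
    rewrite (big_pred1 jk) // => jk'; apply/idP/eqP => [bad'|->//].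
    exact: first_bad_unique bad' bad.
  rewrite big_pred0 // => -[j k]; apply/negP => /and3P[/andP[kn]].
  by have /forallP/(_ j)/forallP/(_ k) := yam; rewrite kn /= => ->.
rewrite (exchange_big_dep xpredT) //= big1 // => -[j k] _.
set S := (\sum_(T | _) _)%R; have SN : S = (- S)%R.
  rewrite -sumrN [LHS](reindex_onto (bender_knuth j k) (bender_knuth j k)); last first.
    by move=> T /andP[ssT bad]; have [] := first_bad_toggle ssT bad.
  apply: eq_big => [T|T].
    apply/idP/idP => [/andP[/andP[ss' bad'] /eqP inv]|/andP[ssT bad]].
      by have [] := first_bad_toggle ss' bad'; rewrite inv => -> ->.
    by have [-> -> -> _] := first_bad_toggle ssT bad; rewrite eqxx.
  case/andP=> /andP[ss' bad'] /eqP inv.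
  by have [_ _ _] := first_bad_toggle ss' bad'; rewrite inv => ->; rewrite opprK.
apply/mpolyP => g; rewrite mcoeff0.
have : (S@_g = - (S@_g))%R by rewrite {1}SN mcoeffN.
by lia.
Qed.

End AlternantSchur.

(** * Littlewood-Richardson coefficients count Yamanouchi tableaux *)

Lemma part_size_le l : is_part l -> size l <= sumn l.
Proof.
case/andP=> _; elim: l => //= x l IH; rewrite inE negb_or => /andP[x0 /IH].
by move: x0; rewrite eq_sym -lt0n; lia.
Qed.

Lemma part_nth_gt0 l i : is_part l -> (0 < nth 0 l i) = (i < size l).
Proof.
case/andP=> _ l0; have [il|li] := ltnP i (size l); last by rewrite nth_default.
by rewrite lt0n; apply: contraNneq l0 => <-; apply: mem_nth.
Qed.

Lemma part_ext l l' : is_part l -> is_part l' ->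
  (forall i, nth 0 l i = nth 0 l' i) -> l = l'.
Proof.
move=> lp l'p same; have le m m' : is_part m -> is_part m' ->
    (forall i, nth 0 m i = nth 0 m' i) -> size m <= size m'.
  move=> mp m'p e; case E: (size m) => [//|s].
  by rewrite -(part_nth_gt0 _ m'p) -e part_nth_gt0 // E.
apply: (@eq_from_nth _ 0) => [|i _]; last exact: same.
by apply/eqP; rewrite eqn_leq !le.
Qed.

Lemma part_of_antitone (f : nat -> nat) N : (forall i, f i.+1 <= f i) ->
  (forall i, N <= i -> f i = 0) ->
  exists2 l, is_part l & forall i, nth 0 l i = f i.
Proof.
move=> f_anti f_out.
have anti i j : i <= j -> f j <= f i.
  by move=> /subnK <-; elim: (j - i) => // d IH; apply: leq_trans (f_anti _) IH.
have ex : exists m, f m == 0 by exists N; rewrite f_out.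
case: (ex_minnP ex) => m /eqP fm m_min; exists (mkseq f m); last first.
  move=> i; have [im|mi] := ltnP i m; first by rewrite nth_mkseq.
  by rewrite nth_default ?size_mkseq //; apply/esym/eqP; rewrite -leqn0 -fm anti.
apply/andP; split.
  apply/(sortedP 0) => i; rewrite size_mkseq => im.
  by rewrite !nth_mkseq ?(ltnW im) //; apply: f_anti.
apply/negP => /mapP[i]; rewrite mem_iota add0n => /andP[_ im] /esym/eqP /m_min.
by rewrite leqNgt im.
Qed.

Lemma sumn_nth l N : size l <= N -> sumn l = \sum_(i < N) nth 0 l i.
Proof.
move=> lN; rewrite sumnE (big_nth 0) big_mkord -(subnKC lN) big_split_ord /=.
by rewrite [X in _ + X]big1 ?addn0 // => i _; rewrite nth_default ?leq_addr.
Qed.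

Lemma exponent_strict n l (i j : 'I_n) : is_part l -> i < j ->
  (exponent n l + staircase n)%MM j < (exponent n l + staircase n)%MM i.
Proof.
move=> lp ij; rewrite !mnmDE !mnmE.
have le : nth 0 l j <= nth 0 l i.
  move: (nat_of_ord j) (ltnW ij) => k /subnK <-.
  elim: (k - i) => // d IH; exact: leq_trans (part_antitone lp _) IH.
by have := ltn_ord j; lia.
Qed.

Lemma exponent_inj n l l' : is_part l -> is_part l' -> size l <= n -> size l' <= n ->
  exponent n l = exponent n l' -> l = l'.
Proof.
move=> lp l'p ln l'n /mnmP E; apply: part_ext => // i.
have [i_n|ni] := ltnP i n; first by have := E (Ordinal i_n); rewrite !mnmE.
by rewrite !nth_default //; lia.
Qed.

Section Coefficients.

Lemma alternant_exponent_coeff n l l' : is_part l -> is_part l' ->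
  size l <= n -> size l' <= n ->
  ((alternant (exponent n l + staircase n)%MM)@_(exponent n l' + staircase n)
   = (l == l')%:R)%R.
Proof.
move=> lp l'p ln l'n; rewrite alternant_coeff.
- congr ((_ : bool)%:R)%R; apply/eqP/eqP => [|->//] E.
  apply: (exponent_inj lp l'p ln l'n); apply/mnmP => i.
  by have /mnmP/(_ i) := E; rewrite !mnmDE => /addIn.
- move=> i j; rewrite leq_eqVlt => /predU1P[/val_inj -> //|ij].
  exact: ltnW (exponent_strict lp ij).
by move=> i j; apply: exponent_strict.
Qed.

Lemma exponent_nil n : exponent n [::] = 0%MM.
Proof. by apply/mnmP => i; rewrite !mnmE nth_nil. Qed.

Lemma alternant_staircase_neq0 n : alternant (staircase n) != 0%R.
Proof.
apply/eqP => E; have := @alternant_exponent_coeff n [::] [::] isT isT isT isT.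
by rewrite exponent_nil add0m E mcoeff0 eqxx.
Qed.

Lemma yamanouchi_everywhere n l a (T : {ffun young l -> 'I_n}) : is_part l ->
  is_part a -> size a <= n -> is_ssyt T -> yamanouchi a T ->
  forall j k, yamanouchi_at (size l) (nth 0 a) (tab_array T) j k.
Proof.
move=> lp ap an ssT /forallP yam j k.
have [jl|lj] := ltnP j (nth 0 l 0); last first.
  by rewrite /yamanouchi_at !letters_right_far // !addn0 part_antitone.
have [kn|nk] := ltnP k.+1 n.
  by have /forallP/(_ (Ordinal (ltnW kn)))/implyP := yam (Ordinal jl); apply.
rewrite /yamanouchi_at (nth_default 0) ?(leq_trans an nk) //.
rewrite /letters_right big1 // => i _; have [_ pn _ _] := tab_array_gt lp ssT.
by rewrite !pn ?subnn //; lia.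
Qed.

(** On top of the empty partition only the tableau with all entries of row [i]
    equal to [i] is Yamanouchi. *)
Lemma yamanouchi_nil n l (T : {ffun young l -> 'I_n}) : is_part l ->
  is_ssyt T -> yamanouchi [::] T ->
  tab_array T =2 fun k i => if i < k then nth 0 l i else 0.
Proof.
move=> lp ssT yam; have gtT := tab_array_gt lp ssT.
have yam_all j k : yamanouchi_at (size l) (nth 0 [::]) (tab_array T) j k.
  exact: yamanouchi_everywhere.
have l_out i : size l <= i -> nth 0 l i = 0 by exact: nth_default.
have rowY := column_to_row_yamanouchi l_out gtT (part_antitone (l := [::]) isT) yam_all.
have const i k : i < k -> tab_array T k.+1 i = tab_array T k i.
  elim/ltn_ind: i k => i IH [//|k]; rewrite ltnS => ik.
  have := rowY i k; rewrite /row_yamanouchi !nth_nil !add0n big_ord_recr /=.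
  rewrite [X in _ <= X]big1 => [|c _]; last first.
    by rewrite IH ?subnn //; have := ltn_ord c; lia.
  by have [_ _ pS _] := gtT; have := pS k.+1 i; lia_sums.
move=> k i; case: ltnP => [ik|ki]; last exact: gt_diag gtT _ _ ki.
have [_ pn _ _] := gtT; rewrite -(pn (k + n)) ?leq_addl //.
suff e d : tab_array T (k + d) i = tab_array T k i by rewrite e.
by elim: d => [|d IH]; rewrite ?addn0 // addnS const // ltn_addr.
Qed.

Lemma alternant_staircase_schur n l : is_part l -> size l <= n.+1 ->
  (alternant (staircase n.+1) * schur n.+1 l
   = alternant (exponent n.+1 l + staircase n.+1)%MM)%R.
Proof.
move=> lp ln; have l_out i : size l <= i -> nth 0 l i = 0 by exact: nth_default.
pose p k i := if i < k then nth 0 l i else 0.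
have gtp : gelfand_tsetlin n.+1 (nth 0 l) p.
  split=> [i|k i nk|k i|k i]; rewrite /p //.
  - by case: ltnP => // ki; rewrite l_out //; lia.
  - by case: (ltnP i k) => // ik; rewrite leqW.
  - by rewrite ltnS; case: ifP => // _; exact: part_antitone.
pose T0 : {ffun young l -> 'I_n.+1} := [ffun => ord0].
pose T := of_array T0 p; have ssT : is_ssyt T by exact: of_array_ssyt.
have pT := tab_array_of_array lp T0 gtp.
have yamT : yamanouchi [::] T.
  apply/forallP => j; apply/forallP => k; apply/implyP => _.
  rewrite /yamanouchi_at !(eq_letters_right _ pT).
  apply: (row_to_column_yamanouchi l_out gtp) => i {}k.
  rewrite /row_yamanouchi !nth_nil !add0n big_ord_recl /p /= subnn add0n.
  apply: leq_sum => c _; rewrite /bump /= add1n !ltnS.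
  by have := part_antitone lp c; do 2!case: ifP; lia.
have uniqT T' : is_ssyt T' && yamanouchi [::] T' -> T' = T.
  case/andP=> ssT' /(yamanouchi_nil lp ssT') pT'.
  by rewrite -(of_arrayK lp T0 ssT'); apply: eq_of_array.
have := @alternant_mul_schur n.+1 l lp [::] isT.
rewrite exponent_nil add0m => ->.
rewrite (big_pred1 T) => [|T']; last first.
  by apply/idP/eqP => [/uniqT //|->]; rewrite ssT.
congr alternant; rewrite addmC; congr (_ + _)%MM; apply/mnmP => i.
rewrite (weightE lp i (leqnn _) ssT) (eq_letters_right _ pT) mnmE.
rewrite /letters_right (eq_bigr (fun c : 'I_(size l) => if c == i :> nat then nth 0 l c else 0)).
  have [il|li] := ltnP i (size l); last first.
    by rewrite big1 ?l_out // => c _; case: eqP => // ci; have := ltn_ord c; lia.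
  rewrite (bigD1 (Ordinal il)) //= eqxx big1 ?addn0 // => c /eqP ci.
  by case: eqP => // E; case: ci; apply: val_inj.
by move=> c _; rewrite /p !subn0; do 3!case: ifP; lia.
Qed.

Lemma schur_eq0 n l : is_part l -> n < size l -> schur n l = 0%R.
Proof.
move=> lp nl; rewrite schurE big_pred0 // => T; apply/negP => ssT.
have gtT := tab_array_gt lp ssT; have [_ pn _ _] := gtT.
have := pn n n (leqnn n); rewrite (gt_diag gtT) // => /esym/eqP.
by rewrite -leqn0 leqNgt part_nth_gt0 // nl.
Qed.

(** Multiplied by the Vandermonde alternant, Schur polynomials have distinct
    dominant monomials. *)
Lemma schur_free n d (c : seq nat -> int) : d <= n.+1 ->
  (\sum_(mu <- partitions d) c mu *: schur n.+1 mu = 0)%R ->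
  forall mu, mu \in partitions d -> c mu = 0%R.
Proof.
move=> dn rel mu mud.
have size_le nu : nu \in partitions d -> is_part nu /\ size nu <= n.+1.
  rewrite mem_partitions => /andP[nup /eqP nud]; split=> //.
  by apply: leq_trans dn; rewrite -nud part_size_le.
have [mup mun] := size_le _ mud.
have := congr1 (fun p => (alternant (staircase n.+1) * p)@_(exponent n.+1 mu + staircase n.+1))%R rel.
rewrite /= mulr0 mcoeff0 mulr_sumr raddf_sum /= => <-.
rewrite (bigD1_seq mu) ?uniq_partitions //=.
rewrite big_seq_cond big1 => [|nu /andP[/size_le[nup nun] ne]].
  rewrite addr0 -scalerAr alternant_staircase_schur // mcoeffZ.
  by rewrite alternant_exponent_coeff // eqxx mulr1.
rewrite -scalerAr alternant_staircase_schur // mcoeffZ.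
by rewrite alternant_exponent_coeff // (negPf ne) mulr0.
Qed.

Definition lr_tableau n a b mu (T : {ffun young b -> 'I_n}) : bool :=
  [&& is_ssyt T, yamanouchi a T
    & (exponent n a + weight T)%MM == exponent n mu].

Definition lr_count n a b mu : nat := #|[pred T | @lr_tableau n a b mu T]|.

Lemma yamanouchi_content n a b (T : {ffun young b -> 'I_n}) : is_part a ->
  is_part b -> size a <= n -> is_ssyt T -> yamanouchi a T ->
  exists2 mu, mu \in partitions (sumn a + sumn b)
            & (exponent n a + weight T)%MM = exponent n mu /\ size mu <= n.
Proof.
move=> ap bp an ssT yam.
pose f i := nth 0 a i + letters_right (size b) (tab_array T) 0 i.
have f_out i : n <= i -> f i = 0.
  move=> ni; rewrite /f nth_default ?(leq_trans an ni) // /letters_right big1 // => c _.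
  by have [_ pn _ _] := tab_array_gt bp ssT; rewrite !pn ?subnn //; lia.
have [mu mup mu_f] := part_of_antitone (f := f) (yamanouchi_everywhere bp ap an ssT yam 0) f_out.
have mun : size mu <= n by rewrite leqNgt -part_nth_gt0 // mu_f f_out.
have E : (exponent n a + weight T)%MM = exponent n mu.
  by apply/mnmP => i; rewrite mnmDE !mnmE (weightE bp i (leqnn _) ssT) mu_f.
exists mu => //; rewrite mem_partitions mup (sumn_nth mun) (sumn_nth an) /=.
have -> : \sum_(i < n) nth 0 mu i = mdeg (exponent n mu).
  by rewrite mdegE; apply: eq_bigr => i _; rewrite mnmE.
rewrite -E mdegD; apply/eqP; congr (_ + _).
  by rewrite mdegE; apply: eq_bigr => i _; rewrite mnmE.
rewrite /weight mdeg_sum (eq_bigr (fun=> 1)) => [|c _]; last by rewrite mdeg1.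
by rewrite sum1_card -card_young cardfE.
Qed.

Lemma schur_product_count n a b : is_part a -> is_part b ->
  size a <= n.+1 ->
  (schur n.+1 a * schur n.+1 b
   = \sum_(mu <- partitions (sumn a + sumn b))
        (lr_count n.+1 a b mu)%:R *: schur n.+1 mu)%R.
Proof.
move=> ap bp an; apply: (mulfI (alternant_staircase_neq0 n.+1)).
rewrite mulrA alternant_staircase_schur // alternant_mul_schur //.
transitivity (\sum_(T : {ffun young b -> 'I_n.+1} | is_ssyt T && yamanouchi a T)
  \sum_(mu <- partitions (sumn a + sumn b) | lr_tableau a mu T)
    (alternant (staircase n.+1) * schur n.+1 mu))%R.
  apply: eq_bigr => T /andP[ssT yam].
  have [mu mud [E mun]] := yamanouchi_content ap bp an ssT yam.
  have mup : is_part mu by move: mud; rewrite mem_partitions => /andP[].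
  rewrite big_mkcond (bigD1_seq mu) ?uniq_partitions //= /lr_tableau ssT yam E eqxx /=.
  rewrite big_seq_cond big1 => [|nu /andP[nud ne]].
    by rewrite addr0 alternant_staircase_schur // -E -!addmA [(_ + weight T)%MM]addmC.
  case: eqP => // Enu; have nup : is_part nu by move: nud; rewrite mem_partitions => /andP[].
  have [nun|nnu] := leqP (size nu) n.+1; last by rewrite schur_eq0 ?mulr0.
  by rewrite (exponent_inj mup nup mun nun Enu) eqxx in ne.
rewrite (exchange_big_dep xpredT) //= mulr_sumr; apply: eq_bigr => mu _.
rewrite -scalerAr sumr_const scaler_nat; congr (_ *+ _)%R.
apply: eq_card => T; rewrite !inE /lr_tableau unfold_in.
by case: (is_ssyt T); case: (yamanouchi a T).
Qed.

End Coefficients.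

(** * Existence and uniqueness of the Littlewood-Richardson expansion *)

Section Restriction.

Variables (m n : nat).
Hypothesis mn : m <= n.

Definition kept_variables : n.-tuple {mpoly int[m]} :=
  [tuple if insub (val i) is Some i' then 'X_(i' : 'I_m) else 0%R | i < n].

Lemma restrict_schur l : (schur n l \mPo kept_variables)%R = schur m l.
Proof.
pose h (T : {ffun young l -> 'I_m}) : {ffun young l -> 'I_n} :=
  [ffun c => widen_ord mn (T c)].
have h_inj : injective h.
  move=> T T' /ffunP E; apply/ffunP => c; apply/val_inj.
  by have := congr1 val (E c); rewrite !ffunE.
have h_ssyt T : is_ssyt (h T) = is_ssyt T.
  by apply: eq_forallb => c; apply: eq_forallb => c'; rewrite !ffunE.
pose h' (T : {ffun young l -> 'I_n}) := [pick T' | h T' == T].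
pose small (T : {ffun young l -> 'I_n}) := [forall c, T c < m].
have image_E (T : {ffun young l -> 'I_n}) :
    ((\prod_(c : young l) 'X_(T c)) \mPo kept_variables
    = \prod_(c : young l) (if insub (val (T c)) is Some i' then 'X_(i' : 'I_m) else 0))%R.
  rewrite (rmorph_prod (comp_mpoly kept_variables)); apply: eq_bigr => c _.
  by rewrite /= comp_mpolyXU -tnth_nth tnth_mktuple.
rewrite /schur raddf_sum (bigID small) /= [X in (_ + X)%R]big1 ?addr0; last first.
  move=> T /andP[_ /forallPn[c Tc]]; rewrite image_E (bigD1 c) //=.
  by rewrite insubN ?mul0r.
rewrite (reindex_omap h h') => [|T /andP[_ /forallP smallT]]; last first.
  rewrite /h'; case: pickP => [T' /eqP /= ->//|none].
  have := none [ffun c => Ordinal (smallT c)]; case/eqP.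
  by apply/ffunP => c; rewrite !ffunE; apply/val_inj.
apply: eq_big => [T|T _]; last first.
  rewrite image_E; apply: eq_bigr => c _; rewrite ffunE /=.
  by rewrite valK.
rewrite h_ssyt /h' -andbA; case: (is_ssyt T) => //=; apply/andP; split.
  by apply/forallP => c; rewrite ffunE /=.
by case: pickP => [T' /eqP/h_inj -> //|/(_ T)]; rewrite eqxx.
Qed.

End Restriction.

Section Expansion.

Variables a b : seq nat.
Hypotheses (a_part : is_part a) (b_part : is_part b).

Local Notation d := (sumn a + sumn b).

Lemma restrict_expansion (c : seq nat -> int) m n : m <= n ->
  (schur n a * schur n b = \sum_(mu <- partitions d) c mu *: schur n mu)%R ->
  (schur m a * schur m b = \sum_(mu <- partitions d) c mu *: schur m mu)%R.
Proof.
move=> mn E; have := congr1 (comp_mpoly (kept_variables m n)) E.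
rewrite rmorphM /= !restrict_schur // => ->; rewrite raddf_sum /=.
by apply: eq_bigr => mu _; rewrite linearZ /= restrict_schur.
Qed.

Lemma expansion_unique (c c' : seq nat -> int) n : d <= n.+1 ->
  (schur n.+1 a * schur n.+1 b = \sum_(mu <- partitions d) c mu *: schur n.+1 mu)%R ->
  (schur n.+1 a * schur n.+1 b = \sum_(mu <- partitions d) c' mu *: schur n.+1 mu)%R ->
  {in partitions d, c =1 c'}.
Proof.
move=> dn E E' mu mud; apply/eqP; rewrite -subr_eq0; apply/eqP.
apply: (schur_free (c := fun mu => (c mu - c' mu)%R) dn) mud.
under eq_bigr do rewrite scalerBl.
by rewrite sumrB -E -E' subrr.
Qed.

(** The coefficients do not depend on the number of variables: restriction from
    many variables to fewer compares them, and they are unique as soon as there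
    are at least as many variables as boxes. *)
Lemma lr_count_expansion n : d <= n.+1 ->
  schur_product_expansion a b (fun mu => (lr_count n.+1 a b mu)%:R%R).
Proof.
move=> dn m; have a_le k : d <= k.+1 -> size a <= k.+1.
  by move=> dk; have := part_size_le a_part; lia.
have [mn|nm] := leqP m n.+1.
  by apply: (restrict_expansion mn); apply: schur_product_count; rewrite ?a_le.
case: m nm => // m nm; have dm : d <= m.+1 by lia.
have Em := schur_product_count a_part b_part (a_le _ dm).
rewrite Em; apply: eq_big_seq => mu mud; congr (_ *: _)%R.
have En := schur_product_count a_part b_part (a_le _ dn).
exact: (expansion_unique dn (restrict_expansion (ltnW nm) Em) En).
Qed.

Lemma LRcoef_expansion : schur_product_expansion a b (LRcoef a b).
Proof.
move=> n; have ex : exists c, schur_product_expansion a b c.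
  by exists (fun mu => (lr_count d.+1 a b mu)%:R%R); apply: lr_count_expansion.
have := ClassicalEpsilon.epsilon_spec (inhabits (fun _ => 0%R)) _ ex n.
by move->; apply: eq_big_seq => mu mud; rewrite /LRcoef mud.
Qed.

Lemma LRcoef_count n mu : d <= n.+1 -> mu \in partitions d ->
  LRcoef a b mu = (lr_count n.+1 a b mu)%:R%R.
Proof.
move=> dn mud.
exact: (expansion_unique dn (LRcoef_expansion _) (lr_count_expansion dn _) mud).
Qed.

Lemma LRcoef_ge0 mu : (0 <= LRcoef a b mu)%R.
Proof.
have [mud|/negPf mud] := boolP (mu \in partitions d); last by rewrite /LRcoef mud.
by rewrite (@LRcoef_count d) // ler0n.
Qed.

Lemma LRcoef_gt0_partitions mu : (0 < LRcoef a b mu)%R -> mu \in partitions d.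
Proof. by rewrite /LRcoef; case: ifP. Qed.

Lemma LRcoef_gt0P n mu : d <= n.+1 ->
  reflect (mu \in partitions d /\ exists T : {ffun young b -> 'I_n.+1}, lr_tableau a mu T)
          (0 < LRcoef a b mu)%R.
Proof.
move=> dn; apply: (iffP idP) => [c_gt0|[mud [T lrT]]]; last first.
  by rewrite (@LRcoef_count n) // ltr0n; apply/card_gt0P; exists T.
have mud := LRcoef_gt0_partitions c_gt0; split=> //.
by move: c_gt0; rewrite (@LRcoef_count n) // ltr0n => /card_gt0P[T]; exists T.
Qed.

End Expansion.

Lemma LRcoefC a b mu : is_part a -> is_part b -> LRcoef a b mu = LRcoef b a mu.
Proof.
move=> ap bp; have [mud|/negPf mud] := boolP (mu \in partitions (sumn a + sumn b)); last first.
  by rewrite /LRcoef mud addnC mud.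
apply: (expansion_unique (leqnSn _) (LRcoef_expansion ap bp _)) => //.
by rewrite mulrC LRcoef_expansion // addnC.
Qed.

(** * Adding and removing boxes in Littlewood-Richardson triples *)

Definition covers (l l' : seq nat) : Prop :=
  exists i : nat, forall j, nth 0 l' j = nth 0 l j + (j == i).

Lemma covers_sumn l l' : covers l l' -> sumn l' = (sumn l).+1.
Proof.
case=> i ll'; pose N := (size l + size l' + i.+1).
rewrite !(@sumn_nth _ N) /N; try lia.
rewrite (eq_bigr _ (fun j _ => ll' (val j))) big_split /= -[RHS]addn1; congr (_ + _).
have iN : i < N by rewrite /N; lia.
rewrite (bigD1 (Ordinal iN)) //= eqxx big1 // => j /eqP ji.
by case: eqP => // E; case: ji; apply: val_inj.
Qed.

Lemma companion_content n p q : companion n p q ->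
  forall i k, q i k = q 0 k + \sum_(l < i) (p k.+1 l - p k l).
Proof.
case=> _ _ mono rel _ i k; elim: i => [|i IH]; first by rewrite big_ord0 addn0.
by rewrite big_ord_recr /= addnA -IH; have := rel i k; have := mono k i; lia.
Qed.

(** A Yamanouchi tableau of shape [b] on top of [a] with total content [mu] loses
    one letter when the reading starts from [a'] instead. In terms of skew
    functions, where [s_b] occurs in [s_(mu/a)] some [s_b'] occurs in
    [s_(mu/a')], for every box that can be removed from the inner border. *)
Lemma LRcoef_transfer a a' b mu : is_part a -> is_part a' -> is_part b ->
  covers a a' -> (forall i, nth 0 a' i <= nth 0 mu i) -> (0 < LRcoef a b mu)%R ->
  exists b', [/\ is_part b', covers b' b & (0 < LRcoef a' b' mu)%R].
Proof.
move=> ap a'p bp aa' a'mu; set n := sumn a + sumn b.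
case/(LRcoef_gt0P ap bp mu (leqnSn n)) => mud [T /and3P[ssT yam /eqP wtT]].
have mup : is_part mu by move: mud; rewrite mem_partitions => /andP[].
have mun : size mu <= n.+1.
  move: mud; rewrite mem_partitions => /andP[_ /eqP mu_n].
  by have := part_size_le mup; rewrite mu_n -/n; lia.
have an : size a <= n.+1 by have := part_size_le ap; rewrite /n; lia.
have bn : size b <= n.+1 by have := part_size_le bp; rewrite /n; lia.
have gtT := tab_array_gt bp ssT; have [p0 pn pS pSS] := gtT.
set p := tab_array T in gtT p0 pn pS pSS.
pose q i k := nth 0 a k + \sum_(l < i) (p k.+1 l - p k l).
have b_out i : size b <= i -> nth 0 b i = 0 by exact: nth_default.
have rowY := column_to_row_yamanouchi b_out gtT (part_antitone ap)
  (yamanouchi_everywhere bp ap an ssT yam).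
have cpq : companion n.+1 p q.
  split=> [k i|k i nk|k i|i k|i k]; rewrite ?pS //; first exact: gt_diag gtT _ _.
  - by rewrite !pn.
  - by rewrite /q big_ord_recr /=; have := pS k i; lia_sums.
  - exact: rowY.
have letters0 (p1 : nat -> nat -> nat) N k :
    \sum_(l < N) (p1 k.+1 l - p1 k l) = letters_right N p1 0 k.
  by apply: eq_bigr => l _; rewrite !subn0.
have q_mu k : q n.+1 k = nth 0 mu k.
  have [kn|nk] := ltnP k n.+1; last first.
    rewrite /q !nth_default ?(leq_trans _ nk) // big1 // => l _.
    by rewrite !pn ?subnn //; lia.
  have /mnmP/(_ (Ordinal kn)) := wtT.
  by rewrite mnmDE !mnmE (weightE bp (Ordinal kn) bn ssT) /= -letters0.
case: aa' => r aa'.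
have [|||t [p' [q' [cpq' strict' q0' qn' rows]]]] := @remove_letter n.+1 p q r cpq.
- exact: pSS.
- move=> k rk; rewrite /q !big_ord0 !addn0 rk.
  by have := part_antitone a'p k; rewrite !aa' rk eqxx ltn_eqF //; lia.
- by rewrite q_mu /q big_ord0 addn0; have := a'mu r; rewrite aa' eqxx; lia.
have [diag stable mono rel qS] := cpq'.
have [b' b'p b'_p] : exists2 b', is_part b' & forall i, nth 0 b' i = p' n.+1 i.
  apply: (@part_of_antitone _ n.+1) => i; last exact: diag.
  exact: leq_trans (strict' n i) (mono _ _).
have b'b : covers b' b by exists t => i; rewrite b'_p rows pn.
have q0a k : q' 0 k = nth 0 a' k by rewrite q0' /q big_ord0 addn0 aa'.
exists b'; split=> //.
have b'n : size b' <= n.+1 by rewrite leqNgt -part_nth_gt0 // b'_p diag.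
have a'n : size a' <= n.+1.
  rewrite leqNgt -part_nth_gt0 // -leqNgt.
  by apply: leq_trans (a'mu _) _; rewrite nth_default.
have da'b' : sumn a' + sumn b' = n.
  by rewrite (covers_sumn (ex_intro _ r aa')) /n (covers_sumn b'b); lia.
apply/(@LRcoef_gt0P _ _ a'p b'p n); first by rewrite da'b'.
split; first by rewrite da'b'.
have gtp' : gelfand_tsetlin n.+1 (nth 0 b') p'.
  by split=> // [i|k i nk]; [exact: diag|rewrite b'_p stable].
pose T0 : {ffun young b' -> 'I_n.+1} := [ffun => ord0].
exists (of_array T0 p'); have ssT' := of_array_ssyt b'p T0 gtp'.
have pT' := tab_array_of_array b'p T0 gtp'.
apply/and3P; split=> //.
  apply/forallP => j; apply/forallP => k; apply/implyP => _.
  rewrite /yamanouchi_at !(eq_letters_right _ pT').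
  apply: (row_to_column_yamanouchi _ gtp') => [i|i {}k]; first exact: nth_default.
  rewrite /row_yamanouchi -!q0a -!(companion_content cpq'); exact: qS.
apply/eqP/mnmP => k; rewrite mnmDE (weightE b'p k b'n ssT') !mnmE.
rewrite (eq_letters_right _ pT') -letters0 -q0a -(companion_content cpq').
by rewrite qn' // q_mu.
Qed.

Lemma sum_gt0P (I : eqType) (r : seq I) (F : I -> int) :
  (forall i, i \in r -> 0 <= F i)%R ->
  (0 < \sum_(i <- r) F i)%R <-> exists2 i, i \in r & (0 < F i)%R.
Proof.
elim: r => [|x r IH] F_ge0; first by rewrite big_nil; split=> // -[].
have [IH1 IH2] := IH (fun i ir => F_ge0 i (mem_behead (s := x :: r) ir)).
have Fx := F_ge0 x (mem_head x r); rewrite big_cons; split=> [pos|[i]].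
  have [Fx0|] := boolP (0 < F x)%R; first by exists x; rewrite ?mem_head.
  move=> nFx; have /IH1[i ir Fi] : (0 < \sum_(i <- r) F i)%R by move: pos nFx Fx; lia_sums.
  by exists i; rewrite // inE ir orbT.
have sum_ge0 : (0 <= \sum_(j <- r) F j)%R.
  by rewrite big_seq_cond; apply: sumr_ge0 => j /andP[jr _]; rewrite F_ge0 // inE jr orbT.
rewrite inE => /predU1P[-> Fi|ir Fi]; first exact: ltr_wpDr.
by apply: ltr_wpDl => //; apply: IH2; exists i.
Qed.

Section Boxes.

Variable n : nat.

Local Notation rho := (staircase n.+1).
Local Notation "l %:X" := (exponent n.+1 l) (at level 2, format "l %:X").

Lemma exponent_up l l' (i : 'I_n.+1) : (forall j, nth 0 l' j = nth 0 l j + (j == i)) ->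
  (l'%:X = l%:X + U_(i))%MM.
Proof.
by move=> ll'; apply/mnmP => j; rewrite mnmDE mnm1E !mnmE ll' eq_sym.
Qed.

Lemma exponent_up_inv l l' (i : 'I_n.+1) : size l <= n.+1 -> size l' <= n.+1 ->
  (l'%:X = l%:X + U_(i))%MM -> covers l l'.
Proof.
move=> ln l'n /mnmP E; exists (val i) => j; have [jn|nj] := ltnP j n.+1.
  by have := E (Ordinal jn); rewrite mnmDE mnm1E !mnmE eq_sym.
by rewrite !nth_default ?(leq_trans _ nj) // gtn_eqF // (leq_trans (ltn_ord i)).
Qed.

(** A box that does not fit makes two exponents of the alternant equal. *)
Lemma alternant_up l (i : 'I_n.+1) : is_part l -> size l <= n.+1 ->
  (exists2 l', is_part l' & forall j, nth 0 l' j = nth 0 l j + (j == i))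
  \/ (alternant (l%:X + rho + U_(i))%MM = 0)%R.
Proof.
move=> lp ln; have [ok|] := boolP ((i == 0 :> nat) || (nth 0 l i < nth 0 l i.-1)).
  left; apply: (@part_of_antitone _ n.+1) => j.
    have := part_antitone lp j; have [ij|_] := eqVneq j.+1 i; last by lia.
    by move: ok; rewrite -ij [j == _]ltn_eqF //=; lia.
  by move=> nj; rewrite nth_default ?(leq_trans ln) //; case: eqP => // E; have := ltn_ord i; lia.
rewrite negb_or => /andP[i0 ge_i]; right.
have i1n : i.-1 < n.+1 by have := ltn_ord i; lia.
apply: (@alternant_eq0 _ _ (Ordinal i1n) i).
  by apply/eqP => /(congr1 val) /=; lia.
have := part_antitone lp i.-1; rewrite prednK ?lt0n // => le_i.
rewrite !mnmDE !mnm1E !mnmE eqxx -val_eqE /=.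
by have := ltn_ord i; case: eqP => /=; lia.
Qed.

(** A box that cannot be removed makes two exponents of the alternant equal,
    except in an empty last row, whose exponent vanishes. *)
Lemma alternant_down l (i : 'I_n.+1) : is_part l -> size l <= n.+1 ->
  (exists2 l', is_part l' & forall j, nth 0 l j = nth 0 l' j + (j == i))
  \/ ((((l%:X + rho) i)%MM)%:R *: alternant (l%:X + rho - U_(i))%MM = 0)%R.
Proof.
move=> lp ln; have [ok|] := ltnP (nth 0 l i.+1) (nth 0 l i).
  left; have [||l' l'p El'] := @part_of_antitone (fun j => nth 0 l j - (j == i)) n.+1.
  - move=> j; have := part_antitone lp j; have [->|_] := eqVneq j i.
      by rewrite gtn_eqF //; lia.
    by lia.
  - by move=> j nj; rewrite nth_default ?(leq_trans ln).
  by exists l' => // j; rewrite El'; case: eqP => [->|]; lia.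
move=> ge_i; right; have eq_i : nth 0 l i.+1 = nth 0 l i.
  by apply/eqP; rewrite eqn_leq ge_i part_antitone.
have [i1n|ni] := ltnP i.+1 n.+1; last first.
  rewrite mnmDE !mnmE -eq_i nth_default ?(leq_trans ln) //.
  have -> : n.+1.-1 - i = 0 by lia.
  by rewrite addn0 mulr0n scale0r.
rewrite (@alternant_eq0 _ _ i (Ordinal i1n)) ?scaler0 //.
  by apply/eqP => /(congr1 val) /=; lia.
rewrite !mnmBE !mnmDE !mnm1E !mnmE eqxx -val_eqE /= eq_i.
by case: eqP; lia.
Qed.

(** The coefficient of [s_l] in a product of Schur polynomials, read off after
    multiplication by the Vandermonde alternant. *)
Lemma alternant_schur_coeff b g l : is_part b -> is_part g -> is_part l ->
  sumn b + sumn g <= n.+1 -> size l <= n.+1 ->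
  ((alternant (b%:X + rho)%MM * schur n.+1 g)@_(l%:X + rho) = LRcoef b g l)%R.
Proof.
move=> bp gp lp dn ln; have bn := part_size_le bp.
rewrite -alternant_staircase_schur //; last first.
  exact: leq_trans bn (leq_trans (leq_addr _ _) dn).
rewrite -mulrA (LRcoef_expansion bp gp) mulr_sumr raddf_sum /=.
have coef (k : seq nat) : k \in partitions (sumn b + sumn g) ->
    ((alternant rho * (LRcoef b g k *: schur n.+1 k))@_(l%:X + rho)
     = LRcoef b g k * (k == l)%:R)%R.
  rewrite mem_partitions => /andP[kp /eqP kd].
  have kn : size k <= n.+1 by rewrite (leq_trans (part_size_le kp)) ?kd.
  by rewrite -scalerAr alternant_staircase_schur // mcoeffZ alternant_exponent_coeff.
rewrite (eq_big_seq _ coef).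
have [lin|lout] := boolP (l \in partitions (sumn b + sumn g)).
  rewrite (bigD1_seq l) ?uniq_partitions //= eqxx mulr1 big1 ?addr0 // => k /negPf->.
  by rewrite mulr0.
rewrite /LRcoef (negPf lout) big_seq big1 // => k kin.
by case: eqP => [E|_]; [rewrite -E kin in lout | rewrite mulr0].
Qed.

Lemma schur_alternant_expansion b g : is_part b -> is_part g ->
  sumn b + sumn g <= n.+1 ->
  (alternant (b%:X + rho)%MM * schur n.+1 g
   = \sum_(k <- partitions (sumn b + sumn g)) LRcoef b g k *: alternant (k%:X + rho)%MM)%R.
Proof.
move=> bp gp dn; have bn := part_size_le bp.
rewrite -alternant_staircase_schur //; last first.
  exact: leq_trans bn (leq_trans (leq_addr _ _) dn).
rewrite -mulrA (LRcoef_expansion bp gp) mulr_sumr; apply: eq_big_seq => k.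
rewrite mem_partitions => /andP[kp /eqP kd]; rewrite -scalerAr alternant_staircase_schur //.
by rewrite (leq_trans (part_size_le kp)) ?kd.
Qed.

Lemma alternant_mul_p1 (m : 'X_{1..n.+1}) :
  (alternant m * (\sum_(i < n.+1) 'X_i) = \sum_(i < n.+1) alternant (m + U_(i))%MM)%R.
Proof.
apply: (@alternant_mul_sym _ _ xpredT (fun i => U_(i)%MM)) => s.
rewrite [RHS](reindex_inj (@perm_inj _ (s^-1)%g)) /=; apply: eq_bigr => i _.
congr mpolyX; apply/mnmP => j; rewrite mnmE !mnm1E.
by rewrite -{1}(permKV s i) (inj_eq perm_inj).
Qed.

Lemma up_term b g l (i : 'I_n.+1) (F := ((alternant (b%:X + rho + U_(i))%MM
     * schur n.+1 g)@_(l%:X + rho))%R) :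
  is_part b -> is_part g -> is_part l -> sumn b + sumn g < n.+1 -> size l <= n.+1 ->
  (F = 0)%R \/ exists b', [/\ is_part b', covers b b' & F = LRcoef b' g l].
Proof.
move=> bp gp lp dn ln; have bn : size b <= n.+1.
  exact: leq_trans (part_size_le bp) (leq_trans (leq_addr _ _) (ltnW dn)).
have [[b' b'p bb']|E] := alternant_up i bp bn; last by left; rewrite /F E mul0r mcoeff0.
have cbb' : covers b b' by exists (val i).
right; exists b'; split=> //; rewrite /F -alternant_schur_coeff ?(covers_sumn cbb') //.
by rewrite (exponent_up bb') -!addmA [(rho + _)%MM]addmC.
Qed.

Lemma up_term_eq b b' g l (i : 'I_n.+1) : is_part b' -> is_part g -> is_part l ->
  sumn b' + sumn g <= n.+1 -> size l <= n.+1 ->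
  (forall j, nth 0 b' j = nth 0 b j + (j == i)) ->
  ((alternant (b%:X + rho + U_(i))%MM * schur n.+1 g)@_(l%:X + rho)
   = LRcoef b' g l)%R.
Proof.
move=> b'p gp lp dn ln bb'; rewrite -alternant_schur_coeff //.
by rewrite (exponent_up bb') -!addmA [(rho + _)%MM]addmC.
Qed.

Lemma down_exponent b b' (i : 'I_n.+1) :
  (forall j, nth 0 b j = nth 0 b' j + (j == i)) ->
  (b%:X + rho - U_(i) = b'%:X + rho)%MM.
Proof.
move=> /exponent_up ->; apply/mnmP => j; rewrite mnmBE !mnmDE; lia.
Qed.

(** The terms of [nabla] of a bialternant contribute Littlewood-Richardson
    coefficients with nonnegative factors. *)
Lemma down_term_ge0 b g l (i : 'I_n.+1) : is_part b -> is_part g -> is_part l ->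
  sumn b + sumn g <= n.+1 -> size l <= n.+1 ->
  (0 <= (((b%:X + rho)%MM i)%:R *: alternant (b%:X + rho - U_(i))%MM
     * schur n.+1 g)@_(l%:X + rho))%R.
Proof.
move=> bp gp lp dn ln; have bn : size b <= n.+1.
  exact: leq_trans (part_size_le bp) (leq_trans (leq_addr _ _) dn).
have [[b' b'p bb']|->] := alternant_down i bp bn; last by rewrite mul0r mcoeff0.
rewrite (down_exponent bb') -scalerAl mcoeffZ alternant_schur_coeff //.
  by rewrite mulr_ge0 ?ler0n ?LRcoef_ge0.
have cbb' : covers b' b by exists (val i).
by move: dn; rewrite (covers_sumn cbb') addSn; apply: ltnW.
Qed.

Lemma nabla_staircase : nabla (alternant rho) = 0%R.
Proof.
rewrite nabla_alternant big1 // => i _.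
have [[l' _ /(_ i)]|] := @alternant_down [::] i isT isT.
  by rewrite nth_nil eqxx addn1.
by rewrite exponent_nil add0m.
Qed.

Lemma coeff_down l k (i : 'I_n.+1) : is_part l -> is_part k ->
  size l <= n.+1 ->
  ((alternant (k%:X + rho - U_(i))%MM)@_(l%:X + rho)
   = ((k%:X + rho - U_(i))%MM == (l%:X + rho)%MM)%:R)%R.
Proof.
move=> lp kp ln; apply: alternant_coeff => [j j' jj'|j j']; last exact: exponent_strict.
move: jj'; rewrite leq_eqVlt => /predU1P[/val_inj -> //|jj'].
by have := exponent_strict kp jj'; rewrite !mnmBE !mnm1E; case: (i == j); case: (i == j'); lia.
Qed.

Lemma coeff_up l k (i : 'I_n.+1) : is_part l -> is_part k ->
  size l <= n.+1 ->
  ((alternant (k%:X + rho + U_(i))%MM)@_(l%:X + rho)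
   = ((k%:X + rho + U_(i))%MM == (l%:X + rho)%MM)%:R)%R.
Proof.
move=> lp kp ln; apply: alternant_coeff => [j j' jj'|j j']; last exact: exponent_strict.
move: jj'; rewrite leq_eqVlt => /predU1P[/val_inj -> //|jj'].
have lt := exponent_strict kp jj'.
rewrite [X in X <= _]mnmDE [X in _ <= X]mnmDE !mnm1E; move: lt.
by case: (i == j); case: (i == j'); lia.
Qed.

End Boxes.

Lemma ord_sum_gt0P n (F : 'I_n -> int) : (forall i, 0 <= F i)%R ->
  (0 < \sum_i F i)%R <-> exists i, (0 < F i)%R.
Proof.
move=> F_ge0; split=> [/sum_gt0P[|i]|[i Fi]] //; first by exists i.
by apply/sum_gt0P => //; exists i => //; rewrite mem_index_enum.
Qed.

(** Both sides expand the coefficient of [s_l] in [s_1 s_b s_g]: on one side the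
    box is added to [b] first, on the other side last. *)
Lemma LRcoef_pieri b g l : is_part b -> is_part g -> is_part l ->
  (exists b', [/\ is_part b', covers b b' & (0 < LRcoef b' g l)%R]) <->
  (exists k, [/\ is_part k, covers k l & (0 < LRcoef b g k)%R]).
Proof.
move=> bp gp lp; set n := sumn b + sumn g + size l.
have dn : sumn b + sumn g < n.+1 by rewrite /n ltnS leq_addr.
have ln : size l <= n.+1 by rewrite leqW // /n leq_addl.
pose V := ((alternant (exponent n.+1 b + staircase n.+1)%MM *
   (\sum_(i < n.+1) 'X_i) * schur n.+1 g)@_(exponent n.+1 l + staircase n.+1))%R.
transitivity (0 < V)%R.
  rewrite /V alternant_mul_p1 mulr_suml raddf_sum /=.
  rewrite ord_sum_gt0P => [|i]; last first.
    by have [->|[b' [b'p _ ->]]] := up_term i bp gp lp dn ln; rewrite ?LRcoef_ge0.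
  split=> [[b' [b'p bb' pos]]|[i]].
    have b'n : sumn b' + sumn g <= n.+1 by rewrite (covers_sumn bb').
    case: bb' => r bb'.
    have rn : r < n.+1.
      apply: leq_trans b'n; rewrite (leq_trans _ (leq_addr _ _)) //.
      apply: leq_trans (part_size_le b'p).
      by rewrite -part_nth_gt0 // bb' eqxx addn1.
    by exists (Ordinal rn); rewrite (@up_term_eq n b b' g l (Ordinal rn)).
  have [->|[b' [b'p bb' ->]]] := up_term i bp gp lp dn ln; first by rewrite ltxx.
  by exists b'.
rewrite /V mulrAC schur_alternant_expansion ?(ltnW dn) // mulr_suml raddf_sum /=.
have coef k : k \in partitions (sumn b + sumn g) ->
   ((LRcoef b g k *: alternant (exponent n.+1 k + staircase n.+1)%MM *
      (\sum_(i < n.+1) 'X_i))@_(exponent n.+1 l + staircase n.+1)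
    = LRcoef b g k * \sum_(i < n.+1)
        ((exponent n.+1 k + staircase n.+1 + U_(i))%MM ==
         (exponent n.+1 l + staircase n.+1)%MM)%:R)%R.
  rewrite mem_partitions => /andP[kp kd]; rewrite -scalerAl mcoeffZ alternant_mul_p1.
  by rewrite raddf_sum; congr (_ * _)%R; apply: eq_bigr => i _; rewrite /= coeff_up.
rewrite (eq_big_seq _ coef) sum_gt0P => [|k _]; last first.
  by rewrite mulr_ge0 ?LRcoef_ge0 ?sumr_ge0.
split=> [[k kin]|[k [kp kl pos]]].
  have kp : is_part k by move: kin; rewrite mem_partitions => /andP[].
  have := LRcoef_ge0 bp gp k; rewrite le0r => /predU1P[->|c_gt0].
    by rewrite mul0r ltxx.
  rewrite pmulr_rgt0 // ord_sum_gt0P // => -[i]; case: eqP => // E _.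
  exists k; split=> //; apply: (@exponent_up_inv n _ _ i) => //.
    move: kin; rewrite mem_partitions => /andP[_ /eqP kd].
    by rewrite (leq_trans (part_size_le kp)) // kd ltnW.
  by apply/mnmP => j; have /mnmP/(_ j) := E; rewrite !mnmDE; lia.
exists k; first exact: LRcoef_gt0_partitions.
rewrite pmulr_rgt0 // ord_sum_gt0P //; case: kl => r kl.
have rn : r < n.+1.
  by apply: leq_trans ln; rewrite -part_nth_gt0 // kl eqxx addn1.
exists (Ordinal rn); rewrite (@exponent_up n k l (Ordinal rn)) //.
by rewrite -!addmA [(staircase _ + _)%MM]addmC eqxx.
Qed.

(** The coefficient of [s_l] in the derivative of [s_b' s_g] is at least that in
    [(nabla s_b') s_g], to which [s_b s_g] contributes positively; but it also
    is a combination of the coefficients of the [s_l'] in [s_b' s_g], for [l']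
    one box larger than [l]. *)
Lemma LRcoef_extend b b' g l : is_part b -> is_part b' -> is_part g -> is_part l ->
  covers b b' -> (0 < LRcoef b g l)%R ->
  exists l', [/\ is_part l', covers l l' & (0 < LRcoef b' g l')%R].
Proof.
move=> bp b'p gp lp bb' pos; set n := sumn b' + sumn g + size l.
have dn : sumn b' + sumn g <= n.+1 by rewrite leqW // /n leq_addr.
have ln : size l <= n.+1 by rewrite leqW // /n leq_addl.
have b'n : size b' <= n.+1.
  exact: leq_trans (part_size_le b'p) (leq_trans (leq_addr _ _) dn).
have gn : size g <= n.+1.
  exact: leq_trans (part_size_le gp) (leq_trans (leq_addl _ _) dn).
pose X k := exponent n.+1 k; pose rho := staircase n.+1.
pose W := ((nabla (alternant (X b' + rho)%MM * schur n.+1 g))@_(X l + rho))%R.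
have W_gt0 : (0 < W)%R.
  rewrite /W nablaM mcoeffD nabla_alternant.
  have rest_ge0 : (0 <= (alternant (X b' + rho)%MM * nabla (schur n.+1 g))@_(X l + rho))%R.
    rewrite -alternant_staircase_schur // mulrAC.
    have -> : (alternant (staircase n.+1) * nabla (schur n.+1 g))%R
        = nabla (alternant (X g + rho)%MM).
      by rewrite -alternant_staircase_schur // nablaM nabla_staircase mul0r add0r.
    rewrite nabla_alternant mulr_suml raddf_sum /= sumr_ge0 // => i _.
    by apply: down_term_ge0; rewrite // addnC.
  rewrite ltr_wpDr // mulr_suml raddf_sum /=.
  apply/ord_sum_gt0P => [i|]; first exact: down_term_ge0.
  case: (bb') => r bb'r; have rn : r < n.+1.
    by apply: leq_trans b'n; rewrite -part_nth_gt0 // bb'r eqxx addn1.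
  exists (Ordinal rn); rewrite (@down_exponent n b' b (Ordinal rn)) //.
  rewrite -scalerAl mcoeffZ alternant_schur_coeff //; last first.
    by apply: leq_trans dn; rewrite (covers_sumn bb') leq_add2r.
  by rewrite mulr_gt0 // ltr0n mnmDE !mnmE bb'r eqxx addn1.
move: W_gt0; rewrite /W schur_alternant_expansion // nabla_sum raddf_sum /=.
have coef k : k \in partitions (sumn b' + sumn g) ->
   ((nabla (LRcoef b' g k *: alternant (X k + rho)%MM))@_(X l + rho)
    = LRcoef b' g k * \sum_(i < n.+1) ((X k + rho)%MM i)%:R *
        ((X k + rho - U_(i))%MM == (X l + rho)%MM)%:R)%R.
  rewrite mem_partitions => /andP[kp kd]; rewrite nablaZ mcoeffZ nabla_alternant.
  rewrite raddf_sum; congr (_ * _)%R; apply: eq_bigr => i _ /=.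
  by rewrite mcoeffZ coeff_down.
rewrite (eq_big_seq _ coef) sum_gt0P => [[k kin]|k _]; last first.
  by rewrite mulr_ge0 ?LRcoef_ge0 // sumr_ge0 // => i _; rewrite mulr_ge0 ?ler0n.
have kp : is_part k by move: kin; rewrite mem_partitions => /andP[].
have := LRcoef_ge0 b'p gp k; rewrite le0r => /predU1P[->|c_gt0].
  by rewrite mul0r ltxx.
rewrite pmulr_rgt0 // ord_sum_gt0P => [[i]|i]; last by rewrite mulr_ge0 ?ler0n.
case: eqP => [E|_]; last by rewrite mulr0 ltxx.
rewrite mulr1 ltr0n => ki; exists k; split=> //.
apply: (@exponent_up_inv n _ _ i) => //.
  move: kin; rewrite mem_partitions => /andP[_ /eqP kd].
  by rewrite (leq_trans (part_size_le kp)) // kd.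
apply/mnmP => j; have /mnmP/(_ j) := E; rewrite mnmBE !mnmDE mnm1E.
by have [<-|] := eqVneq i j; move: ki; rewrite ?mnmDE /X; lia.
Qed.

(** * Newell-Littlewood triples *)

Lemma LRcoef_gt0_sumn a b mu : (0 < LRcoef a b mu)%R -> sumn mu = sumn a + sumn b.
Proof. by move/LRcoef_gt0_partitions; rewrite mem_partitions => /andP[_ /eqP]. Qed.

Lemma LRcoef_gt0_part a b mu : (0 < LRcoef a b mu)%R -> is_part mu.
Proof. by move/LRcoef_gt0_partitions; rewrite mem_partitions => /andP[]. Qed.

Lemma LRcoef_gt0_sub a b mu : is_part a -> is_part b -> (0 < LRcoef a b mu)%R ->
  forall i, nth 0 a i <= nth 0 mu i.
Proof.
move=> ap bp /(LRcoef_gt0P ap bp mu (leqnSn _))[_ [T /and3P[_ _ /eqP/mnmP E]]] i.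
have [i_n|ni] := ltnP i (sumn a + sumn b).+1.
  by have := E (Ordinal i_n); rewrite mnmDE !mnmE /= => <-; apply: leq_addr.
rewrite nth_default //; apply: leq_trans (part_size_le ap) _; lia.
Qed.

Lemma LRcoef_nil mu : is_part mu -> LRcoef [::] mu mu = 1%R.
Proof.
move=> mup; have mun := leq_trans (part_size_le mup) (leqnSn _).
rewrite -(@alternant_schur_coeff (sumn mu)) // exponent_nil add0m.
by rewrite alternant_staircase_schur // alternant_exponent_coeff // eqxx.
Qed.

Lemma covers_nth l l' : covers l l' -> forall i, nth 0 l i <= nth 0 l' i.
Proof. by case=> r ll' i; rewrite ll' leq_addr. Qed.

Lemma exists_removable_box l : is_part l -> 0 < sumn l ->
  exists2 l', is_part l' & covers l' l.
Proof.
move=> lp l_gt0; have sl : 0 < size l by case: (l) l_gt0.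
have [||l' l'p El'] := @part_of_antitone (fun j => nth 0 l j - (j == (size l).-1)) (size l).
- move=> j; have [->|_] := eqVneq j (size l).-1; last by have := part_antitone lp j; lia.
  by rewrite nth_default // prednK.
- by move=> j lj; rewrite nth_default.
exists l' => //; exists (size l).-1 => j; rewrite El'.
have [->|_] := eqVneq j (size l).-1; last by rewrite subn0 addn0.
by rewrite subnK // part_nth_gt0 // prednK.
Qed.

Lemma exists_addable_box l k : is_part l -> is_part k ->
  (forall i, nth 0 l i <= nth 0 k i) -> sumn l < sumn k ->
  exists l', [/\ is_part l', covers l l' & forall i, nth 0 l' i <= nth 0 k i].
Proof.
move=> lp kp lk lt_lk; pose N := size l + size k.
have ex : exists i, nth 0 l i < nth 0 k i.
  have [/existsP[i li]|/existsPn none] := boolP [exists i : 'I_N, nth 0 l i < nth 0 k i].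
    by exists i.
  move: lt_lk; rewrite ltnNge (@sumn_nth _ N) ?leq_addl // (@sumn_nth _ N) ?leq_addr //.
  by rewrite leq_sum // => i _; have := none i; rewrite -leqNgt.
case: (ex_minnP ex) => i li i_min.
have before j : j < i -> nth 0 k j <= nth 0 l j.
  by move=> ji; rewrite leqNgt; apply: contraL ji => /i_min; rewrite leqNgt.
have [||l' l'p El'] := @part_of_antitone (fun j => nth 0 l j + (j == i)) N.
- move=> j; have := part_antitone lp j; have [ji|_] := eqVneq j.+1 i; last by lia.
  by have := part_antitone kp j; have := before j; rewrite -ji in li *; rewrite ltn_eqF //; lia.
- move=> j Nj; rewrite nth_default ?(leq_trans (leq_addr _ _) Nj) //.
  case: eqP => // ji; move: li; rewrite -ji (nth_default 0 (s := k)) //.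
  by apply: leq_trans Nj; rewrite leq_addl.
exists l'; split=> //; first by exists i.
by move=> j; rewrite El'; have := lk j; case: eqP => [->|]; lia.
Qed.

Lemma young_subset l l' : (forall i, nth 0 l i <= nth 0 l' i) ->
  (young l `<=` young l')%fset.
Proof.
move=> ll'; apply/fsubsetP => -[i j]; rewrite !in_young => /leq_trans; exact.
Qed.

Lemma sumn_le l l' : (forall i, nth 0 l i <= nth 0 l' i) -> sumn l <= sumn l'.
Proof. by move=> /young_subset/fsubset_leq_card; rewrite !card_young. Qed.

Lemma part_meet mu nu : is_part mu -> is_part nu ->
  exists k, [/\ is_part k, forall i, nth 0 k i = minn (nth 0 mu i) (nth 0 nu i)
    & #|` young_symdiff mu nu|%fset + (sumn k).*2 = sumn mu + sumn nu].
Proof.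
move=> mup nup.
have [||k kp Ek] := @part_of_antitone (fun i => minn (nth 0 mu i) (nth 0 nu i)) (size mu).
- by move=> i; have := part_antitone mup i; have := part_antitone nup i; lia.
- by move=> i mi; rewrite nth_default // min0n.
exists k; split=> //.
have yk : young k = (young mu `&` young nu)%fset.
  by apply/fsetP => -[i j]; rewrite in_fsetI !in_young Ek leq_min.
rewrite -!card_young yk /young_symdiff cardfsU !cardfsD [(young nu `&` _)%fset]fsetIC.
have -> : ((young mu `\` young nu) `&` (young nu `\` young mu) = fset0)%fset.
  by apply/fsetP => c; rewrite in_fsetI !in_fsetD in_fset0; case: (c \in young mu); rewrite ?andbF.
have := fsubset_leq_card (fsubsetIl (young mu) (young nu)).
have := fsubset_leq_card (fsubsetIr (young mu) (young nu)).
by rewrite cardfs0; lia.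
Qed.

Definition nl_triple mu nu lambda a b g : Prop :=
  [/\ is_part a, is_part b & is_part g] /\
  [/\ 0 < LRcoef a b mu, 0 < LRcoef a g nu & 0 < LRcoef b g lambda]%R.

Lemma NLnumber_gt0P mu nu lambda :
  (0 < NLnumber mu nu lambda)%R <-> exists a b g, nl_triple mu nu lambda a b g.
Proof.
have part_of d l : l \in partitions_upto d -> is_part l.
  by rewrite mem_partitions_upto => /andP[].
have term_ge0 a b g : is_part a -> is_part b -> is_part g ->
    (0 <= LRcoef a b mu * LRcoef a g nu * LRcoef b g lambda)%R.
  by move=> ap bp gp; rewrite !mulr_ge0 ?LRcoef_ge0.
rewrite /NLnumber sum_gt0P => [|a /part_of ap]; last first.
  rewrite big_seq sumr_ge0 // => b /part_of bp.
  by rewrite big_seq sumr_ge0 // => g /part_of gp; apply: term_ge0.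
split=> [[a /part_of ap]|[a [b [g [[ap bp gp] [c1 c2 c3]]]]]].
  rewrite sum_gt0P => [[b /part_of bp]|b /part_of bp]; last first.
    by rewrite big_seq sumr_ge0 // => g /part_of gp; apply: term_ge0.
  rewrite sum_gt0P => [[g /part_of gp]|g /part_of gp]; last exact: term_ge0.
  have := LRcoef_ge0 ap bp mu; rewrite le0r => /predU1P[->|c1]; first by rewrite !mul0r ltxx.
  have := LRcoef_ge0 ap gp nu; rewrite le0r => /predU1P[->|c2].
    by rewrite mulr0 mul0r ltxx.
  by rewrite pmulr_rgt0 ?mulr_gt0 // => c3; exists a, b, g.
have [e1 e2] := (LRcoef_gt0_sumn c1, LRcoef_gt0_sumn c2).
exists a; first by rewrite mem_partitions_upto ap e1 leq_addr.
rewrite sum_gt0P => [|b' /part_of bp']; last first.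
  by rewrite big_seq sumr_ge0 // => g' /part_of gp'; apply: term_ge0.
exists b; first by rewrite mem_partitions_upto bp e1 leq_addl.
rewrite sum_gt0P => [|g' /part_of gp']; last exact: term_ge0.
exists g; first by rewrite mem_partitions_upto gp e2 leq_addl.
by rewrite !mulr_gt0.
Qed.

Lemma nl_triple_sumn mu nu lambda a b g : nl_triple mu nu lambda a b g ->
  [/\ sumn mu = sumn a + sumn b, sumn nu = sumn a + sumn g
    & sumn lambda = sumn b + sumn g].
Proof. by case=> _ [/LRcoef_gt0_sumn ? /LRcoef_gt0_sumn ? /LRcoef_gt0_sumn ?]. Qed.

Lemma nl_triple_meet mu nu lambda a b g k : nl_triple mu nu lambda a b g ->
  (forall i, nth 0 k i = minn (nth 0 mu i) (nth 0 nu i)) ->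
  forall i, nth 0 a i <= nth 0 k i.
Proof.
case=> [[ap bp gp] [c1 c2 _]] Ek i; rewrite Ek leq_min.
by rewrite (LRcoef_gt0_sub ap bp c1) (LRcoef_gt0_sub ap gp c2).
Qed.

(** A box moves from both [b] and [g] to [a], hence two boxes leave [lambda]. *)
Lemma nl_shrink mu nu lambda : is_part mu -> is_part nu ->
  (0 < NLnumber mu nu lambda)%R -> #|` young_symdiff mu nu|%fset < sumn lambda ->
  exists l, [/\ is_part l, (0 < NLnumber mu nu l)%R,
    (young l `<=` young lambda)%fset & sumn lambda = sumn l + 2].
Proof.
move=> mup nup /NLnumber_gt0P[a [b [g tri]]] big.
have [k [kp Ek card_k]] := part_meet mup nup.
have [e1 e2 e3] := nl_triple_sumn tri; have ak := nl_triple_meet tri Ek.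
have [[ap bp gp] [c1 c2 c3]] := tri.
have [|a' [a'p aa' a'k]] := exists_addable_box ap kp ak; first by lia.
have [i|b' [b'p b'b c1']] := LRcoef_transfer ap a'p bp aa' _ c1.
  by apply: leq_trans (a'k i) _; rewrite Ek geq_minl.
have [i|g' [g'p g'g c2']] := LRcoef_transfer ap a'p gp aa' _ c2.
  by apply: leq_trans (a'k i) _; rewrite Ek geq_minr.
have lp := LRcoef_gt0_part c3.
have [l1 [l1p l1l c4]] : exists k, [/\ is_part k, covers k lambda & (0 < LRcoef b' g k)%R].
  by apply/(LRcoef_pieri b'p gp lp); exists b.
have [l2 [l2p l2l c5]] : exists k, [/\ is_part k, covers k l1 & (0 < LRcoef g' b' k)%R].
  by apply/(LRcoef_pieri g'p b'p l1p); exists g; rewrite LRcoefC.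
exists l2; split=> //.
- by apply/NLnumber_gt0P; exists a', b', g'; split; split; rewrite // LRcoefC.
- apply: young_subset => i; exact: leq_trans (covers_nth l2l i) (covers_nth l1l i).
by rewrite (covers_sumn l1l) (covers_sumn l2l) addn2.
Qed.

(** Pieri's rule removes a box from [mu] together with the box of [a], and read in
    the other direction gives it back as a box of [b]. *)
Lemma LRcoef_exchange a a' b mu : is_part a -> is_part a' -> is_part b ->
  covers a' a -> (0 < LRcoef a b mu)%R ->
  exists b', [/\ is_part b', covers b b' & (0 < LRcoef a' b' mu)%R].
Proof.
move=> ap a'p bp a'a c; have mup := LRcoef_gt0_part c.
have [k [kp kmu c']] : exists k, [/\ is_part k, covers k mu & (0 < LRcoef a' b k)%R].
  by apply/(LRcoef_pieri a'p bp mup); exists a.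
have [b' [b'p bb' c'']] :
    exists b', [/\ is_part b', covers b b' & (0 < LRcoef b' a' mu)%R].
  by apply/(LRcoef_pieri bp a'p mup); exists k; rewrite LRcoefC.
by exists b'; rewrite LRcoefC.
Qed.

(** A box moves from [a] to both [b] and [g], hence two boxes join [lambda]. *)
Lemma nl_grow mu nu lambda :
  (0 < NLnumber mu nu lambda)%R -> sumn lambda < sumn mu + sumn nu ->
  exists l, [/\ is_part l, (0 < NLnumber mu nu l)%R,
    (young lambda `<=` young l)%fset & sumn l = sumn lambda + 2].
Proof.
move=> /NLnumber_gt0P[a [b [g tri]]] small.
have [e1 e2 e3] := nl_triple_sumn tri; have [[ap bp gp] [c1 c2 c3]] := tri.
have [|a' a'p a'a] := exists_removable_box ap; first by lia.
have [b' [b'p bb' c1']] := LRcoef_exchange ap a'p bp a'a c1.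
have [g' [g'p gg' c2']] := LRcoef_exchange ap a'p gp a'a c2.
have [l1 [l1p ll1 c4]] := LRcoef_extend bp b'p gp (LRcoef_gt0_part c3) bb' c3.
rewrite LRcoefC // in c4.
have [l2 [l2p ll2 c5]] := LRcoef_extend gp g'p b'p l1p gg' c4.
exists l2; split=> //.
- by apply/NLnumber_gt0P; exists a', b', g'; split; split; rewrite // LRcoefC.
- apply: young_subset => i; exact: leq_trans (covers_nth ll1 i) (covers_nth ll2 i).
by rewrite (covers_sumn ll2) (covers_sumn ll1) addn2.
Qed.

Lemma exists_LRcoef_gt0 b g : is_part b -> is_part g ->
  exists l, (0 < LRcoef b g l)%R.
Proof.
have [d] := ubnP (sumn b); elim: d b => // d IH b bd bp gp.
have [b0|] := posnP (sumn b).
  have -> : b = [::] by apply: size0nil; have := part_size_le bp; lia.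
  by exists g; rewrite LRcoef_nil.
move=> /(exists_removable_box bp)[b' b'p b'b].
have [|l c] := IH b' _ b'p gp; first by rewrite (covers_sumn b'b) in bd.
by have [l' [_ _ c']] := LRcoef_extend b'p bp gp (LRcoef_gt0_part c) b'b c; exists l'.
Qed.

(** Starting from [a] empty, where [lambda] has all boxes of [mu] and [nu], the
    size of [lambda] descends by two until it reaches the symmetric difference. *)
Lemma nl_all_sizes mu nu d : is_part mu -> is_part nu ->
  #|` young_symdiff mu nu|%fset + d.*2 <= sumn mu + sumn nu ->
  exists l, [/\ is_part l, (0 < NLnumber mu nu l)%R
    & sumn l + d.*2 = sumn mu + sumn nu].
Proof.
move=> mup nup; elim: d => [|d IH] le_d.
  have [l c] := exists_LRcoef_gt0 mup nup; exists l; split.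
  - exact: LRcoef_gt0_part c.
  - apply/NLnumber_gt0P; exists [::], mu, nu; split; split=> //; by rewrite LRcoef_nil.
  by rewrite addn0 (LRcoef_gt0_sumn c).
have [|l [lp nl sl]] := IH; first by lia.
have [|l' [l'p nl' _ sl']] := nl_shrink mup nup nl; first by lia.
by exists l'; split=> //; lia.
Qed.

Theorem theorem3p1 (mu nu : seq nat) (mu_part : is_part mu)
    (nu_part : is_part nu) :
  [/\ (* (I) *)
      forall k : nat,
        (exists lambda : seq nat,
          [/\ is_part lambda, sumn lambda = k
            & (0 < NLnumber mu nu lambda)%R])
        <-> (k = #|` young_symdiff mu nu|%fset %[mod 2]
             /\ #|` young_symdiff mu nu|%fset <= k <= sumn mu + sumn nu),
      (* (II) *)
      forall lambda : seq nat,
        is_part lambda -> (0 < NLnumber mu nu lambda)%R ->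
        #|` young_symdiff mu nu|%fset < sumn lambda ->
        exists lambda_dd : seq nat,
          [/\ is_part lambda_dd, (0 < NLnumber mu nu lambda_dd)%R,
              (young lambda_dd `<=` young lambda)%fset
            & sumn lambda = sumn lambda_dd + 2]
    & (* (III) *)
      forall lambda : seq nat,
        is_part lambda -> (0 < NLnumber mu nu lambda)%R ->
        sumn lambda < sumn mu + sumn nu ->
        exists lambda_uu : seq nat,
          [/\ is_part lambda_uu, (0 < NLnumber mu nu lambda_uu)%R,
              (young lambda `<=` young lambda_uu)%fset
            & sumn lambda_uu = sumn lambda + 2]].
Proof.
split=> [k|lambda _|lambda _]; [|exact: nl_shrink|exact: nl_grow].
have [m [mp Em card_m]] := part_meet mu_part nu_part.
split=> [[lambda [_ <- /NLnumber_gt0P[a [b [g tri]]]]]|[par /andP[lo hi]]].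
  have [e1 e2 e3] := nl_triple_sumn tri.
  have am := sumn_le (nl_triple_meet tri Em).
  by split; lia.
have [|l [lp nl sl]] := @nl_all_sizes mu nu ((sumn mu + sumn nu - k)./2) mu_part nu_part.
  by lia.
by exists l; split=> //; lia.
Qed.
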